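(* Suppose $\sigma^1,\dots,\sigma^m$ is a collection of conformal Killing forms of respective ranks $r_1,\dots,r_m$, where $\bigl(\sum_{i=1}^m r_i\bigr)-m$ is an even number. Then $$\sigma^1_{(a}\cdot\sigma^2_b\cdot\ \cdots\ \cdot\sigma^m_{c)_0}$$ is a conformal Killing $m$-tensor, where $\sigma^1_a\cdot\sigma^2_b\cdot\cdots\cdot\sigma^m_c$ indicates any (complete) contraction of the collection $\sigma^1,\dots,\sigma^m$ over the suppressed indices.
   Context: $M$ is a smooth $n$-manifold, $n\ge3$, with a conformal structure $[g]$ (any signature); all objects are smooth. $\mathcal E[w]$: conformal densities of weight $w$ (a choice $g\in[g]$ trivialises $\mathcal E[w]$; under $\hat g=e^{2\Upsilon}g$ the representing function $f$ becomes $e^{w\Upsilon}f$); $[w]$ after a bundle means tensoring with it. $\mathbf g_{ab}$ is the conformal metric (tautological section of $S^2T^*M[2]$), used to raise, lower and contract abstract indices. $\nabla$ is the Levi-Civita connection of a chosen $g\in[g]$, acting also on densities via the trivialisation. A conformal Killing form of rank $k$, $1\le k\le n-1$, is a weighted $k$-form $\sigma_{a^1\cdots a^k}\in\mathcal E^k[k+1]$ such that the projection of $\nabla_c\sigma_{a^1\cdots a^k}$ to the trace-free part of $\{f_{ca^1\cdots a^k}=f_{c[a^1\cdots a^k]}: f_{[ca^1\cdots a^k]}=0\}$ vanishes (a conformally invariant condition). A conformal Killing $m$-tensor is a symmetric trace-free tensor $t_{b\cdots c}\in\mathcal E_{(b\cdots c)_0}[2m]$ of valence $m$ with $\nabla_{(a}t_{b\cdots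 c)_0}=0$, where $(\cdots)_0$ denotes the symmetric trace-free part. In $\sigma^1_a\cdot\sigma^2_b\cdots\sigma^m_c$ one index of each form is left free (displayed) and the remaining $\sum r_i-m$ indices are suppressed and contracted in pairs using the inverse conformal metric. *)

(* Defs.v *)
From HB Require Import structures.
From mathcomp Require Export all_boot all_order all_algebra all_fingroup.
From mathcomp Require Export all_classical all_reals all_analysis.

Set Implicit Arguments.
Unset Strict Implicit.
Unset Printing Implicit Defensive.

Import Order.TTheory GRing.Theory Num.Theory numFieldNormedType.Exports.

Local Open Scope classical_set_scope.
Local Open Scope ring_scope.

(* -------------------------------------------------------------------------- *)
(* Smooth functions on open subsets of R^n                                    *)
(* -------------------------------------------------------------------------- *)

Section Smooth.
Context {R : realType} {n : nat}.
Implicit Types (U : set 'rV[R]_n) (f : 'rV[R]_n -> R).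

Definition partial (i : 'I_n) f : 'rV[R]_n -> R :=
  fun x => 'D_(delta_mx 0 i) f x.

Fixpoint Ck (k : nat) U f : Prop :=
  (forall x, U x -> {for x, continuous f}) /\
  match k with
  | 0 => True
  | k'.+1 => forall i : 'I_n,
      (forall x, U x -> derivable f x (delta_mx 0 i)) /\ Ck k' U (partial i f)
  end.

Definition smooth_on U f : Prop := forall k, Ck k U f.

End Smooth.

(* -------------------------------------------------------------------------- *)
(* Smooth manifolds                                                           *)
(* -------------------------------------------------------------------------- *)

(* The smooth structure is given by an atlas, not necessarily maximal.  The
   chart i has domain [dom i]; [param i] is the inverse of [coord i], and the
   values of both outside of [dom i], resp. [coord i @` dom i], are junk. *)
Record smooth_manifold (R : realType) (n : nat) := SmoothManifold {
  carrier :> topologicalType;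
  chart : Type;
  dom : chart -> set carrier;
  coord : chart -> carrier -> 'rV[R]_n;
  param : chart -> 'rV[R]_n -> carrier;
  manifold_hausdorff : hausdorff_space carrier;
  manifold_second_countable : @second_countable carrier;
  dom_cover : forall p, exists i, dom i p;
  dom_open : forall i, open (dom i);
  image_open : forall i, open (coord i @` dom i);
  coordK : forall i p, dom i p -> param i (coord i p) = p;
  coord_continuous : forall i p, dom i p -> {for p, continuous (coord i)};
  param_continuous : forall i x, (coord i @` dom i) x ->
    {for x, continuous (param i)};
  transition_smooth : forall i j (b : 'I_n),
    smooth_on [set x | (coord i @` dom i) x /\ dom j (param i x)]
              (fun x => coord j (param i x) 0 b)
}.

Section Manifold.
Context {R : realType} {n : nat}.
Variable M : smooth_manifold R n.

Definition chart_image (i : chart M) : set 'rV[R]_n := coord i @` dom i.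

Definition overlap (i j : chart M) : set 'rV[R]_n :=
  [set x | chart_image i x /\ dom j (param i x)].

Definition transition (i j : chart M) (x : 'rV[R]_n) : 'rV[R]_n :=
  coord j (param i x).

(* Rows are indexed by the target (chart j), columns by the source (chart i). *)
Definition transition_jacobian (i j : chart M) (x : 'rV[R]_n) : 'M[R]_n :=
  \matrix_(b, a) partial a (fun y => transition i j y 0 b) x.

Definition smooth_fun (f : M -> R) : Prop :=
  forall i, smooth_on (chart_image i) (fun x => f (param i x)).

(* Pseudo-Riemannian metrics of any signature, by their components. *)
Record metric := Metric {
  gmx : chart M -> 'rV[R]_n -> 'M[R]_n;
  metric_sym : forall i x, chart_image i x -> (gmx i x)^T = gmx i x;
  metric_nondegenerate : forall i x, chart_image i x -> gmx i x \in unitmx;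
  metric_smooth : forall i a b,
    smooth_on (chart_image i) (fun x => gmx i x a b);
  metric_transform : forall i j x, overlap i j x ->
    gmx i x = (transition_jacobian i j x)^T
              *m gmx j (transition i j x) *m transition_jacobian i j x
}.

(* h = e^{2 Ups} g *)
Definition conformally_related (g h : metric) (Ups : M -> R) : Prop :=
  smooth_fun Ups /\
  forall i x, chart_image i x ->
    gmx h i x = expR (2 * Ups (param i x)) *: gmx g i x.

Record conformal_structure := ConformalStructure {
  metrics_of : set metric;
  metrics_ofP : exists g0, forall h,
    metrics_of h <-> exists Ups, conformally_related g0 h Ups
}.

End Manifold.

Arguments gmx {R n M}.

(* -------------------------------------------------------------------------- *)
(* Pointwise tensor algebra: components of covariant tensors of valence k     *)
(* -------------------------------------------------------------------------- *)

Definition multiindex (n k : nat) := {ffun 'I_k -> 'I_n}.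
Definition tens (R : realType) (n k : nat) := {ffun {ffun 'I_k -> 'I_n} -> R}.

Section TensorAlgebra.
Context {R : realType} {n : nat}.

Definition set_index k (a : multiindex n k) (s : 'I_k) (d : 'I_n) :
    multiindex n k :=
  [ffun t => if t == s then d else a t].

Definition perm_index k (a : multiindex n k) (s : 'S_k) : multiindex n k :=
  [ffun t => a (s t)].

Definition cons_index k (c : 'I_n) (a : multiindex n k) : multiindex n k.+1 :=
  [ffun t => if unlift ord0 t is Some s then a s else c].

Definition tail_index k (a : multiindex n k.+1) : multiindex n k :=
  [ffun s => a (lift ord0 s)].

Definition symmetric_tensor k (f : tens R n k) : Prop :=
  forall (s : 'S_k) a, f (perm_index a s) = f a.

Definition alternating_tensor k (f : tens R n k) : Prop :=
  forall (s : 'S_k) a, f (perm_index a s) = (-1) ^+ s * f a.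

Definition symmetrization k (f : tens R n k) : tens R n k :=
  [ffun a => (k`!%:R)^-1 * \sum_(s : 'S_k) f (perm_index a s)].

Definition antisymmetrization k (f : tens R n k) : tens R n k :=
  [ffun a => (k`!%:R)^-1 * \sum_(s : 'S_k) (-1) ^+ s * f (perm_index a s)].

Definition trace_free k (g : 'M[R]_n) (f : tens R n k) : Prop :=
  forall p q : 'I_k, p != q -> forall a,
    \sum_(c < n) \sum_(d < n)
      invmx g c d * f (set_index (set_index a p c) q d) = 0.

(* Sums of tensors g_{a_p a_q} u(a), p < q, where u does not involve the slots
   p and q: the span of the insertions of g in two slots. *)
Definition pure_trace k (g : 'M[R]_n) (f : tens R n k) : Prop :=
  exists u : 'I_k -> 'I_k -> tens R n k,
    (forall p q a c, u p q (set_index a p c) = u p q a /\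
                     u p q (set_index a q c) = u p q a) /\
    (forall a, f a = \sum_(p < k) \sum_(q < k | (p < q)%N)
                        g (a p) (a q) * u p q a).

(* h is the trace-free part of f: all tensors of valence k split as the direct
   sum of the trace-free and the pure trace ones (g is nondegenerate). *)
Definition is_trace_free_part k (g : 'M[R]_n) (f h : tens R n k) : Prop :=
  trace_free g h /\ pure_trace g (f - h).

(* h = f_{(b ... c)_0} *)
Definition is_tf_sym_part k (g : 'M[R]_n) (f h : tens R n k) : Prop :=
  symmetric_tensor h /\ is_trace_free_part g (symmetrization f) h.

(* The element characterised by is_tf_sym_part (it exists and is unique for g
   symmetric and nondegenerate). *)
Definition tf_sym_part k (g : 'M[R]_n) (f : tens R n k) : tens R n k :=
  xget 0 [set h | is_tf_sym_part g f h].

(* f_{c a1...ak} = f_{c [a1...ak]} and f_{[c a1...ak]} = 0 *)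
Definition hook_tensor k (f : tens R n k.+1) : Prop :=
  (forall c, alternating_tensor ([ffun a => f (cons_index c a)] : tens R n k)) /\
  antisymmetrization f = 0.

(* For f alternating in its last k slots, h is the projection of f to the
   trace-free hook tensors: first remove the totally skew part of f, then
   take the trace-free part. *)
Definition is_tf_hook_part k (g : 'M[R]_n) (f h : tens R n k.+1) : Prop :=
  hook_tensor h /\ is_trace_free_part g (f - antisymmetrization f) h.

End TensorAlgebra.

(* -------------------------------------------------------------------------- *)
(* Weighted tensor fields and the Levi-Civita connection                      *)
(* -------------------------------------------------------------------------- *)

(* A weighted covariant tensor field: its components in the trivialisation
   given by a metric of the conformal class and in a chart. *)
Definition wfield (R : realType) (n : nat) (M : smooth_manifold R n) (k : nat) :=
  metric M -> chart M -> 'rV[R]_n -> tens R n k.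

Section Fields.
Context {R : realType} {n : nat} {M : smooth_manifold R n}.

(* T is a smooth section of the k-th tensor power of T^*M, tensored with the
   densities of weight w *)
Definition weighted_tensor k (C : conformal_structure M) (w : R)
    (T : wfield M k) : Prop :=
  [/\ (forall g, metrics_of C g -> forall i a,
         smooth_on (chart_image i) (fun x => T g i x a)),
      (forall g, metrics_of C g -> forall i j x, overlap i j x -> forall a,
         T g i x a =
         \sum_(b : multiindex n k)
            (\prod_(s < k) transition_jacobian i j x (b s) (a s))
            * T g j (transition i j x) b)
    & (forall g h Ups, metrics_of C g -> metrics_of C h ->
         conformally_related g h Ups ->
         forall i x, chart_image i x -> forall a,
         T h i x a = expR (w * Ups (param i x)) * T g i x a)].

(* Gamma^d_{ab} *)
Definition christoffel (g : metric M) (i : chart M) (x : 'rV[R]_n)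
    (d a b : 'I_n) : R :=
  2^-1 * \sum_(e < n) invmx (gmx g i x) d e *
    (partial a (fun y => gmx g i y b e) x
     + partial b (fun y => gmx g i y a e) x
     - partial e (fun y => gmx g i y a b) x).

(* (nabla_{a_0} T)_{a_1...a_k} for the Levi-Civita connection of g; densities
   are differentiated through the trivialisation, so T is evaluated at g. *)
Definition nabla k (g : metric M) (T : wfield M k) (i : chart M)
    (x : 'rV[R]_n) : tens R n k.+1 :=
  [ffun a : {ffun 'I_k.+1 -> 'I_n} =>
    partial (a ord0) (fun y => T g i y (tail_index a)) x
    - \sum_(s < k) \sum_(d < n)
        christoffel g i x d (a ord0) (a (lift ord0 s))
        * T g i x (set_index (tail_index a) s d)].

(* In the next two definitions g is the metric chosen in the conformal class C
   to define nabla; being conformally invariant, they do not depend on it. *)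
Definition conformal_killing_form (C : conformal_structure M) (g : metric M)
    k (sigma : wfield M k) : Prop :=
  [/\ (1 <= k <= n.-1)%N,
      weighted_tensor C k.+1%:R sigma,
      (forall h, metrics_of C h -> forall i x, chart_image i x ->
         alternating_tensor (sigma h i x))
    & (forall i x, chart_image i x ->
         is_tf_hook_part (gmx g i x) (nabla g sigma i x) 0)].

Definition conformal_killing_tensor (C : conformal_structure M) (g : metric M)
    m (t : wfield M m) : Prop :=
  [/\ weighted_tensor C (2 * m)%:R t,
      (forall h, metrics_of C h -> forall i x, chart_image i x ->
         symmetric_tensor (t h i x) /\ trace_free (gmx h i x) (t h i x))
    & (forall i x, chart_image i x ->
         is_tf_sym_part (gmx g i x) (nabla g t i x) 0)].

Definition tf_sym_field m (T : wfield M m) : wfield M m :=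
  fun h i x => tf_sym_part (gmx h i x) (T h i x).

End Fields.

(* -------------------------------------------------------------------------- *)
(* Complete contractions of a collection of forms                             *)
(* -------------------------------------------------------------------------- *)

Section Contraction.
Context {m : nat} {r : 'I_m -> nat}.

(* The slot number s of the i-th form. *)
Definition slot := {i : 'I_m & 'I_(r i)}.

Definition mkslot (i : 'I_m) (s : 'I_(r i)) : slot :=
  Tagged (fun i => 'I_(r i)) s.

Variable free : forall i : 'I_m, 'I_(r i).

Definition suppressed (x : slot) : bool :=
  [forall i : 'I_m, x != mkslot (free i)].

(* The suppressed slots are contracted in the pairs {x, pair x}. *)
Definition complete_pairing (pair : slot -> slot) : Prop :=
  forall x, suppressed x ->
    [/\ suppressed (pair x), pair x != x & pair (pair x) = x].

(* The sum is over the values A of all the indices that agree with b on the free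
   ones; enum_rank only serves to count each pair {x, pair x} once.  The inverse
   conformal metric is represented by the inverse of h in the trivialisation
   given by h. *)
Definition contraction (R : realType) (n : nat) (M : smooth_manifold R n)
    (sigma : forall i : 'I_m, wfield M (r i)) (pair : slot -> slot) :
    wfield M m :=
  fun h i x =>
  [ffun b : {ffun 'I_m -> 'I_n} =>
    \sum_(A : {ffun slot -> 'I_n} | [forall l, A (mkslot (free l)) == b l])
      (\prod_(l < m) sigma l h i x [ffun s : 'I_(r l) => A (mkslot s)])
      * \prod_(y : slot | suppressed y && (enum_rank y < enum_rank (pair y))%N)
          invmx (gmx h i x) (A y) (A (pair y))].

End Contraction.

(* Main.v *)
From HB Require Import structures.
Require Import Defs.
From mathcomp Require Import ring lra zify.
From mathcomp Require mpoly.
Import -(notations) mpoly.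
Import Order.TTheory GRing.Theory Num.Theory numFieldNormedType.Exports.
Local Open Scope ring_scope.
Set Implicit Arguments.
Unset Strict Implicit.
Unset Printing Implicit Defensive.

(** A tensor of valence k on a tangent space defines a homogeneous polynomial of
    degree k in the coordinates of a tangent vector X, which determines its
    symmetrization.  Under this dictionary a symmetrized pure trace is a multiple
    of the metric quadric g(X,X), and a symmetric tensor is trace-free exactly
    when its polynomial is harmonic for the Laplacian built from the inverse
    metric.  The symmetrized covariant derivative becomes the derivation D along
    the geodesic spray, which sends a function f to X^c d_c f and the coordinate
    X^a to - Gamma^a_{ce} X^c X^e ([geodesic_derive_tensor_poly]).  As the
    Levi-Civita connection is metric, D kills the quadric
    ([geodesic_derive_quadric]).  So the equation for a conformal Killing tensor
    says that the quadric divides D of its polynomial, and this condition only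
    depends on the polynomial modulo the quadric: the contraction of the forms
    may be used in place of its trace-free symmetric part.

    D of the contraction is the sum over the forms sigma^l of the same contraction
    with nabla_X sigma^l in place of sigma^l, because the inverse metrics are
    parallel ([geodesic_derive_contract]).  The conformal Killing form equation
    gives nabla_c sigma_{a_1...a_k} = omega_{c a_1...a_k} + sum_s g_{c a_s} w_s(a)
    with omega totally skew and w_s independent of a_s ([hook_decomposition]).
    The term omega vanishes since X is inserted in two of its slots.  In the
    other terms, if s is the free slot, g(X,X) splits off.  If s is a contracted
    slot, X is moved through the metric to the partner of s; when this partner
    belongs to another form, X also fills the free slot of that form, and
    skewness gives zero.  If two slots of one form are contracted together, the
    whole contraction is zero ([contract_internal]).

    It remains that the trace-free part is a smooth tensor of the right weight.
    Its existence in every signature comes from the Fischer decomposition: the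
    product of the operators lambda_j - g(X,X) Laplacian, for suitable numbers
    lambda_j > 0, is up to a constant the projection to harmonic polynomials along
    the multiples of the quadric ([laplacian_fischer0], [fischer_quadricM0]).  This
    formula is polynomial in g, in its inverse and in the tensor, hence smooth;
    uniqueness of the decomposition makes it compatible with coordinate changes
    and with rescalings of the metric. *)

(** * Harmonic polynomials of a quadratic form *)

Lemma mnm_predK n (mu : multinom n) c : (0 < mu c)%N ->
  mnm_add (mnm1 c) (mnm_sub mu (mnm1 c)) = mu.
Proof.
move=> mu_c; apply/mnmP => i; rewrite mnmDE mnmBE mnm1E.
by case: eqVneq => [<-|_]; rewrite ?add0n ?subn0 // add1n subn1 prednK.
Qed.

Section Harmonic.
Context {R : realType} {n : nat}.
Implicit Types (g : 'M[R]_n) (p q F : mpoly n R) (k : R).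

Local Notation var c := (mpolyX R (mnm1 c) : mpoly n R).

(** The polynomial g(X,X). *)
Definition quadric g : mpoly n R :=
  \sum_(c < n) \sum_(d < n) g c d *: (var c * var d).

Definition laplacian g F : mpoly n R :=
  \sum_(c < n) \sum_(d < n) invmx g c d *: mderiv d (mderiv c F).

(** Homogeneity of degree k, as an eigenvalue equation for the Euler operator.
    This form allows negative degrees, where only 0 is homogeneous, so that
    degrees can be lowered without case distinctions. *)
Definition euler_degree k F : Prop :=
  \sum_(c < n) var c * mderiv c F = k *: F.

Lemma mderiv_var c d : mderiv c (var d) = (d == c)%:R%:A.
Proof.
rewrite mderivX mnm1E; case: eqVneq => [->|_]; last by rewrite !scale0r.
by rewrite !scale1r -[X in mpolyX _ X](_ : mnm0 = _) ?mpolyX0 //;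
  apply/mnmP => i; rewrite mnmBE mnm0E subnn.
Qed.

Lemma mderiv_sum c (I : Type) (r : seq I) (P : pred I) (F : I -> mpoly n R) :
  mderiv c (\sum_(i <- r | P i) F i) = \sum_(i <- r | P i) mderiv c (F i).
Proof. exact: raddf_sum. Qed.

Lemma laplacian_is_linear g : linear (laplacian g).
Proof.
move=> k p q; rewrite /laplacian scaler_sumr -big_split; apply: eq_bigr => c _.
rewrite scaler_sumr -big_split; apply: eq_bigr => d _.
by rewrite !mderivD !mderivZ scalerDr !scalerA [k * _]mulrC.
Qed.

HB.instance Definition _ g := GRing.isLinear.Build R (mpoly n R) (mpoly n R) _
  (laplacian g) (laplacian_is_linear g).

Lemma laplacianZ g k F : laplacian g (k *: F) = k *: laplacian g F.
Proof. exact: linearZ. Qed.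

Lemma laplacianN g F : laplacian g (- F) = - laplacian g F.
Proof. exact: raddfN. Qed.

Lemma sum_delta (V : lmodType R) (c : 'I_n) (F : 'I_n -> V) :
  \sum_(d < n) (c == d)%:R *: F d = F c.
Proof.
rewrite (bigD1 c) //= eqxx scale1r big1 ?addr0 // => d /negbTE.
by rewrite eq_sym => ->; rewrite scale0r.
Qed.

Lemma sum_deltar (V : lmodType R) (c : 'I_n) (F : 'I_n -> V) :
  \sum_(d < n) (d == c)%:R *: F d = F c.
Proof. by under eq_bigr do rewrite eq_sym; exact: sum_delta. Qed.

Lemma sym_mxE (A : 'M[R]_n) c d : A^T = A -> A c d = A d c.
Proof. by move=> AS; rewrite -[in LHS]AS mxE. Qed.

Lemma mderiv_quadric g c : g^T = g ->
  mderiv c (quadric g) = 2 *: \sum_(e < n) g c e *: var e.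
Proof.
move=> gS; rewrite /quadric mderiv_sum.
under eq_bigr => a _.
  rewrite mderiv_sum.
  under eq_bigr => b _ do
    rewrite mderivZ mderivM !mderiv_var -scalerAl -scalerAr mul1r mulr1 scalerDr
      !scalerA [g a b * (a == c)%:R]mulrC [g a b * (b == c)%:R]mulrC -!scalerA.
  rewrite big_split /= sum_deltar -scaler_sumr.
  over.
rewrite big_split /= sum_deltar scaler_nat mulr2n addrC; congr (_ + _).
by apply: eq_bigr => e _; rewrite (sym_mxE _ _ gS).
Qed.

Lemma sum_invmx g c d : g \in unitmx ->
  \sum_(e < n) invmx g c e * g e d = (c == d)%:R.
Proof. by move=> gU; have := congr1 (fun A : 'M[R]_n => A c d) (mulVmx gU); rewrite !mxE. Qed.

Lemma invmx_sym g : g^T = g -> (invmx g)^T = invmx g.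
Proof. by move=> gS; rewrite trmx_inv gS. Qed.

Lemma sum_invmx_tr g : g^T = g -> g \in unitmx ->
  \sum_(c < n) \sum_(d < n) invmx g c d * g c d = n%:R.
Proof.
move=> gS gU; rewrite -[RHS](_ : \sum_(c < n) 1 = _); last first.
  by rewrite sumr_const card_ord.
apply: eq_bigr => c _; transitivity ((c == c)%:R : R); last by rewrite eqxx.
by rewrite -(sum_invmx _ _ gU); apply: eq_bigr => d _; rewrite (sym_mxE d c gS).
Qed.

(** Two derivatives of a product with g(X,X): both on the quadric give the trace
    2n, and one on each factor give 4 times the Euler operator. *)
Lemma laplacian_quadricM g k q : g^T = g -> g \in unitmx -> euler_degree k q ->
  laplacian g (quadric g * q)
  = (2 * n%:R + 4 * k) *: q + quadric g * laplacian g q.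
Proof.
move=> gS gU qk; pose l c := \sum_(e < n) g c e *: var e.
have dl c d : mderiv d (l c) = (g c d)%:A.
  rewrite /l mderiv_sum; under eq_bigr => e _ do
    rewrite mderivZ mderiv_var scalerA mulrC -scalerA.
  by rewrite sum_deltar.
have linv d : \sum_(c < n) invmx g c d *: l c = var d.
  under eq_bigr do rewrite /l scaler_sumr.
  rewrite exchange_big /=.
  under eq_bigr => e _.
    under eq_bigr do rewrite scalerA.
    rewrite -scaler_suml -[X in X *: _](_ : (d == e)%:R = _); last first.
      rewrite -(sum_invmx _ _ gU); apply: eq_bigr => c _.
      by rewrite (sym_mxE _ _ (invmx_sym gS)).
    over.
  by rewrite sum_delta.
have linv' d : \sum_(c < n) invmx g d c *: l c = var d.
  by rewrite -[RHS]linv; apply: eq_bigr => c _; rewrite (sym_mxE _ _ (invmx_sym gS)).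
have E c d : mderiv d (mderiv c (quadric g * q)) =
    (2 * g c d) *: q + 2 *: (l c * mderiv d q) + 2 *: (l d * mderiv c q)
    + quadric g * mderiv d (mderiv c q).
  rewrite mderivM mderiv_quadric // -/(l c) mderivD !mderivM.
  rewrite mderiv_quadric // -/(l d) mderivZ dl.
  rewrite -!scalerAl mul1r scalerA !addrA; congr (_ + _ + _ + _).
have E' c d : invmx g c d *: mderiv d (mderiv c (quadric g * q)) =
    (2 * (invmx g c d * g c d)) *: q + 2 *: ((invmx g c d *: l c) * mderiv d q)
    + 2 *: ((invmx g c d *: l d) * mderiv c q)
    + quadric g * (invmx g c d *: mderiv d (mderiv c q)).
  rewrite E !scalerDr; congr (_ + _ + _ + _).
  - by rewrite scalerA mulrCA.
  - by rewrite -scalerAl !scalerA mulrC.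
  - by rewrite -scalerAl !scalerA mulrC.
  - by rewrite scalerAr.
rewrite /laplacian.
under eq_bigr => c _.
  under eq_bigr => d _ do rewrite E'.
  rewrite !big_split /= -mulr_sumr -!scaler_sumr -scaler_suml -mulr_sumr.
  over.
rewrite !big_split /= -mulr_sumr -!scaler_sumr -scaler_suml -mulr_sumr.
rewrite sum_invmx_tr //; congr (_ + _).
rewrite exchange_big /=.
under [X in _ + 2 *: X + _]eq_bigr => d _ do rewrite -mulr_suml linv.
under [X in _ + _ + 2 *: X]eq_bigr => c _ do rewrite -mulr_suml linv'.
rewrite qk !scalerA -!scalerDl; congr (_ *: _); ring.
Qed.

Lemma euler_degreeZ k a F : euler_degree k F -> euler_degree k (a *: F).
Proof.
rewrite /euler_degree => Fk; under eq_bigr do rewrite mderivZ -scalerAr.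
by rewrite -scaler_sumr Fk !scalerA mulrC.
Qed.

Lemma euler_degreeD k F p : euler_degree k F -> euler_degree k p ->
  euler_degree k (F + p).
Proof.
rewrite /euler_degree => Fk pk; under eq_bigr do rewrite mderivD mulrDr.
by rewrite big_split /= Fk pk scalerDr.
Qed.

Lemma euler_degree0 k : euler_degree k 0.
Proof. by rewrite /euler_degree scaler0 big1 // => c _; rewrite mderiv0 mulr0. Qed.

Lemma euler_degree_sum k (I : Type) (r : seq I) (P : pred I) (F : I -> mpoly n R) :
  (forall i, P i -> euler_degree k (F i)) ->
  euler_degree k (\sum_(i <- r | P i) F i).
Proof.
move=> Fk; elim/big_rec: _ => [|i p Pi pk]; first exact: euler_degree0.
by apply: euler_degreeD => //; apply: Fk.
Qed.

Lemma euler_degreeM k k' p q : euler_degree k p -> euler_degree k' q ->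
  euler_degree (k + k') (p * q).
Proof.
rewrite /euler_degree => pk qk.
under eq_bigr => c _ do rewrite mderivM mulrDr [X in X + _]mulrA [X in _ + X]mulrCA.
by rewrite big_split /= -mulr_suml -mulr_sumr pk qk -scalerAl -scalerAr scalerDl.
Qed.

Lemma euler_degree_var c : euler_degree 1 (var c).
Proof.
rewrite /euler_degree; under eq_bigr do rewrite mderiv_var -scalerAr mulr1.
by rewrite sum_delta scale1r.
Qed.

Lemma euler_degree_mderiv k c F : euler_degree k F -> euler_degree (k - 1) (mderiv c F).
Proof.
move=> /(congr1 (mderiv c)); rewrite mderiv_sum mderivZ.
under eq_bigr do rewrite mderivM mderiv_var -scalerAl mul1r.
rewrite big_split /= sum_deltar => E; rewrite /euler_degree.
rewrite scalerBl scale1r -E [RHS]addrC addKr; apply: eq_bigr => d _.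
by rewrite mderiv_comm.
Qed.

Lemma euler_degree_quadric g : euler_degree 2 (quadric g).
Proof.
apply: euler_degree_sum => c _; apply: euler_degree_sum => d _.
by apply: euler_degreeZ; apply: euler_degreeM; exact: euler_degree_var.
Qed.

Lemma euler_degree_laplacian g k F :
  euler_degree k F -> euler_degree (k - 2) (laplacian g F).
Proof.
move=> Fk; apply: euler_degree_sum => c _; apply: euler_degree_sum => d _.
apply: euler_degreeZ; rewrite (_ : k - 2 = k - 1 - 1); last by ring.
by do 2!apply: euler_degree_mderiv.
Qed.

Lemma euler_degreeN k F : euler_degree k F -> euler_degree k (- F).
Proof. by move=> Fk; rewrite -[- F]scaleN1r; exact: euler_degreeZ. Qed.

Lemma euler_degree_quadricM g k F :
  euler_degree (k - 2) F -> euler_degree k (quadric g * F).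
Proof.
move=> Fk; rewrite -[X in euler_degree X](subrK 2) addrC.
exact: euler_degreeM (euler_degree_quadric g) Fk.
Qed.

(** The Euler operator multiplies each monomial by its degree. *)
Lemma euler_degree_mcoeff k F mu :
  euler_degree k F -> mcoeff mu F * (mdeg mu)%:R = mcoeff mu F * k.
Proof.
move=> /(congr1 (mcoeff mu)); rewrite mcoeffZ => E.
rewrite [RHS]mulrC -E [LHS]mulrC mdegE natr_sum mulr_suml raddf_sum; apply: eq_bigr => c _ /=.
case: (posnP (mu c)) => [mu0|mu_gt0].
  rewrite mu0 mul0r mcoeffM big1 // => -[[a ?] [b ?]] /= /eqP e.
  rewrite mcoeffX; case: eqVneq => [ea|]; last by rewrite mul0r.
  by move: mu0; rewrite e mnmDE -ea mnm1E eqxx.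
pose nu := mnm_sub mu (mnm1 c).
have munu : mu = mnm_add (mnm1 c) nu by rewrite mnm_predK.
rewrite {3}munu [var c * _]mulrC mcoeffMX mcoeff_deriv.
rewrite [mnm_add nu _](_ : _ = mu); last first.
  by rewrite munu; apply/mnmP => i; rewrite !mnmDE addnC.
by rewrite mulr_natl mnmBE mnm1E eqxx subn1 prednK.
Qed.

Lemma euler_degree_lt0 k F : euler_degree k F -> k < 0 -> F = 0.
Proof.
move=> Fk k0; apply/mpolyP => mu; rewrite mcoeff0; apply/eqP.
have /eqP := euler_degree_mcoeff mu Fk; rewrite -subr_eq0 -mulrBr mulf_eq0.
case/orP => //; rewrite gt_eqF // subr_gt0; exact: lt_le_trans k0 (ler0n _ _).
Qed.

Lemma iter_laplacian0 g k F j : euler_degree k F -> k < 2 * j%:R ->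
  iter j (laplacian g) F = 0.
Proof.
elim: j k F => [|j IH] k F Fk kj.
  by apply: (euler_degree_lt0 Fk); rewrite mulr0 in kj.
rewrite iterSr; apply: IH (euler_degree_laplacian g Fk) _.
by move: kj; rewrite -natr1; lra.
Qed.

(** The eigenvalue of F |-> g(X,X) Lap(F) on the polynomials of degree k of the
    form g(X,X)^j H with H harmonic. *)
Definition fischer_eigenvalue (k : R) (j : nat) : R :=
  2 * j%:R * (n%:R + 2 * k - 2 * j%:R - 2).

(** Kills the summand g(X,X)^j H of the harmonic decomposition in degree k, and
    multiplies the harmonic summand by lambda_j. *)
Definition fischer_factor g k j F : mpoly n R :=
  fischer_eigenvalue k j *: F - quadric g * laplacian g F.

Fixpoint fischer g k (j : nat) F : mpoly n R :=
  if j is j'.+1 then fischer_factor g k j'.+1 (fischer g k j' F) else F.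

(** The multiple of the quadric subtracted by [fischer] in [fischer_divE], kept
    explicit because it has to be differentiated along with the metric. *)
Fixpoint fischer_quotient g k (j : nat) F : mpoly n R :=
  if j is j'.+1 then fischer_eigenvalue k j'.+1 *: fischer_quotient g k j' F
                     + laplacian g (fischer g k j' F) else 0.

Lemma fischer_divE g k j F :
  fischer g k j F = (\prod_(i < j) fischer_eigenvalue k i.+1) *: F
                    - quadric g * fischer_quotient g k j F.
Proof.
elim: j => [|j IH]; first by rewrite big_ord0 scale1r mulr0 subr0.
rewrite [LHS]/= /fischer_factor {1}IH big_ord_recr /= scalerBr scalerA.
by rewrite [_ * fischer_eigenvalue _ _]mulrC mulrDr opprD addrA scalerAr.
Qed.

Lemma euler_degree_fischer_factor g k j F :
  euler_degree k F -> euler_degree k (fischer_factor g k j F).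
Proof.
move=> Fk; apply: euler_degreeD; first exact: euler_degreeZ.
by apply/euler_degreeN/euler_degree_quadricM/euler_degree_laplacian.
Qed.

Lemma euler_degree_fischer g k j F :
  euler_degree k F -> euler_degree k (fischer g k j F).
Proof. by move=> Fk; elim: j => //= j; exact: euler_degree_fischer_factor. Qed.

Section Nondegenerate.
Variable g : 'M[R]_n.
Hypotheses (gS : g^T = g) (gU : g \in unitmx).

(** Passing the Laplacian through shifts (k, j) to (k - 2, j - 1), since the
    eigenvalues satisfy lambda_{j+1}(k) - lambda_1(k) = lambda_j(k - 2).  At j = 0
    the eigenvalue lambda_0 is zero. *)
Lemma laplacian_fischer_factor k j F : euler_degree k F ->
  laplacian g (fischer_factor g k j.+1 F)
  = fischer_factor g (k - 2) j (laplacian g F).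
Proof.
move=> Fk; rewrite /fischer_factor raddfB /= laplacianZ.
rewrite (laplacian_quadricM gS gU (euler_degree_laplacian g Fk)).
rewrite opprD addrA -scalerBl; congr (_ *: _ - _).
by rewrite /fischer_eigenvalue -natr1; ring.
Qed.

Lemma fischer_factor_quadricM k j q : euler_degree (k - 2) q ->
  fischer_factor g k j.+1 (quadric g * q)
  = quadric g * fischer_factor g (k - 2) j q.
Proof.
move=> qk; rewrite /fischer_factor (laplacian_quadricM gS gU qk).
rewrite [RHS]mulrBr mulrDr opprD addrA -[quadric g * (_ *: _)]scalerAr.
rewrite -[quadric g * (_ *: _)]scalerAr -scalerBl; congr (_ *: _ - _).
by rewrite /fischer_eigenvalue -natr1; ring.
Qed.

Lemma fischer_factor0 k F :
  fischer_factor g k 0 F = - (quadric g * laplacian g F).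
Proof. by rewrite /fischer_factor /fischer_eigenvalue mulr0 mul0r scale0r sub0r. Qed.

Lemma laplacian_fischerS k j F : euler_degree k F ->
  laplacian g (fischer g k j.+1 F)
  = fischer g (k - 2) j (- (quadric g * laplacian g (laplacian g F))).
Proof.
move=> Fk; elim: j => [|j IH]; first by rewrite /= laplacian_fischer_factor // fischer_factor0.
rewrite [fischer g k _ _]/= laplacian_fischer_factor; last exact: (@euler_degree_fischer g k j.+1).
by rewrite [laplacian _ _]IH.
Qed.

Lemma fischerS_quadricM k j q : euler_degree (k - 2) q ->
  fischer g k j.+1 (quadric g * q)
  = quadric g * fischer g (k - 2) j (- (quadric g * laplacian g q)).
Proof.
move=> qk; elim: j => [|j IH]; first by rewrite /= fischer_factor_quadricM // fischer_factor0.
rewrite [LHS]/= [X in fischer_factor _ _ _ X]IH fischer_factor_quadricM //.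
apply/euler_degree_fischer/euler_degreeN/euler_degree_quadricM.
exact: euler_degree_laplacian.
Qed.

Lemma fischer_linearN k j F : fischer g k j (- F) = - fischer g k j F.
Proof. by elim: j => //= j ->; rewrite /fischer_factor laplacianN scalerN mulrN opprD. Qed.

(** Each factor that is moved past the quadric leaves one Laplacian acting on q. *)
Lemma fischer_quadricM0 k j q : euler_degree (k - 2) q ->
  iter j (laplacian g) q = 0 -> fischer g k j (quadric g * q) = 0.
Proof.
elim: j k q => [|j IH] k q qk; first by move=> /= ->; rewrite mulr0.
rewrite iterSr => q0; rewrite fischerS_quadricM // fischer_linearN IH ?oppr0 ?mulr0 //.
exact: euler_degree_laplacian.
Qed.

(** After one step the Laplacian of [fischer] is [fischer] of a multiple of the
    quadric, which [fischer_quadricM0] annihilates. *)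
Lemma laplacian_fischer0 k j F : euler_degree k F ->
  iter j.+1 (laplacian g) F = 0 -> laplacian g (fischer g k j F) = 0.
Proof.
case: j => [|j] Fk //; rewrite !iterSr => F0.
rewrite laplacian_fischerS // fischer_linearN fischer_quadricM0 ?oppr0 //.
by do 2!apply: euler_degree_laplacian.
Qed.

Lemma fischer_harmonic k j F : laplacian g F = 0 ->
  fischer g k j F = (\prod_(i < j) fischer_eigenvalue k i.+1) *: F.
Proof.
move=> F0; elim: j => [|j IH]; first by rewrite big_ord0 scale1r.
rewrite /= IH /fischer_factor laplacianZ F0 scaler0 mulr0 subr0 scalerA.
by rewrite big_ord_recr mulrC.
Qed.
End Nondegenerate.

(** The bound on j says that the power j + 1 of the quadric fits in degree m, which
    is why [harmonic_part] has as many factors as half of the degree. *)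
Lemma fischer_eigenvalue_gt0 m j : (0 < n)%N -> (j.*2.+1 < m)%N ->
  0 < fischer_eigenvalue m%:R j.+1.
Proof.
move=> n0 jm; rewrite /fischer_eigenvalue.
have n1 : 1 <= n%:R :> R by rewrite ler1n.
have m2 : 2 * j.+1%:R <= m%:R :> R by rewrite -natrM ler_nat mul2n.
have j0 : 0 <= j%:R :> R by [].
by rewrite -natr1 in m2 *; apply: mulr_gt0; lra.
Qed.
End Harmonic.

(** * Multi-indices and exponents *)

Section Indices.
Context {n : nat}.

(** The operation [set_index] for an arbitrary finite type of slots, which is also
    needed for the slots of a family of forms. *)
Definition upd (I : finType) (a : {ffun I -> 'I_n}) (s : I) (d : 'I_n) :
    {ffun I -> 'I_n} := [ffun t => if t == s then d else a t].

Lemma upd_same (I : finType) (a : {ffun I -> 'I_n}) s d : upd a s d s = d.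
Proof. by rewrite ffunE eqxx. Qed.

Lemma upd_other (I : finType) (a : {ffun I -> 'I_n}) s d t :
  t != s -> upd a s d t = a t.
Proof. by rewrite ffunE => /negbTE ->. Qed.

Lemma upd_upd (I : finType) (a : {ffun I -> 'I_n}) s d e :
  upd (upd a s d) s e = upd a s e.
Proof. by apply/ffunP => t; rewrite !ffunE; case: eqP. Qed.

Lemma upd_id (I : finType) (a : {ffun I -> 'I_n}) s : upd a s (a s) = a.
Proof. by apply/ffunP => t; rewrite !ffunE; case: eqP => // ->. Qed.

(** Exchanging the entry in slot s with a summed index is an involution.  This is
    the form in which dummy indices are renamed below. *)
Lemma sum_swap (V : nmodType) (I : finType) s
    (F : {ffun I -> 'I_n} -> 'I_n -> V) :
  \sum_a \sum_d F a d = \sum_a \sum_d F (upd a s d) (a s).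
Proof.
rewrite !pair_big /=.
rewrite (reindex (fun x : {ffun I -> 'I_n} * 'I_n => (upd x.1 s x.2, x.1 s))) //=.
exists (fun x : {ffun I -> 'I_n} * 'I_n => (upd x.1 s x.2, x.1 s)) => -[a d] _ /=;
  by rewrite upd_upd upd_same upd_id.
Qed.

Lemma sum_upd (V : nmodType) (I : finType) s (F : {ffun I -> 'I_n} -> V) :
  \sum_a \sum_d F (upd a s d) = (\sum_a F a) *+ n.
Proof.
rewrite -(sum_swap s (fun a _ => F a)) -sumrMnl; apply: eq_bigr => a _.
by rewrite sumr_const card_ord.
Qed.

Lemma big_perm_recl (V : Type) (idx : V) (op : Monoid.com_law idx) m
    (F : 'S_m.+1 -> V) :
  \big[op/idx]_s F s
  = \big[op/idx]_j \big[op/idx]_(s : 'S_m) F (lift_perm ord0 j s).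
Proof.
rewrite pair_big /= (reindex (fun x : 'I_m.+1 * 'S_m => lift_perm ord0 x.1 x.2)) //=.
apply/onW_bij/inj_card_bij => [[j s] [k t] /= /permP e|]; last first.
  by rewrite card_prod card_ord !card_Sn factS.
have jk : j = k by have := e ord0; rewrite !lift_perm_id.
rewrite jk in e *; congr pair; apply/permP => i.
by have := e (lift ord0 i); rewrite !lift_perm_lift => /lift_inj.
Qed.

Lemma sum_cons_index (V : nmodType) k (F : multiindex n k.+1 -> V) :
  \sum_a F a = \sum_c \sum_(a : multiindex n k) F (cons_index c a).
Proof.
rewrite pair_big /= (reindex (fun p : 'I_n * multiindex n k => cons_index p.1 p.2)) //=.
exists (fun a : multiindex n k.+1 => (a ord0, tail_index a)) => [[c a] _|a _] /=.
  congr pair; first by rewrite ffunE unlift_none.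
  by apply/ffunP => s; rewrite !ffunE liftK.
by apply/ffunP => s; rewrite ffunE; case: unliftP => [t|] ->; rewrite ?ffunE.
Qed.

Lemma cons_index0 k c (a : multiindex n k) : cons_index c a ord0 = c.
Proof. by rewrite ffunE unlift_none. Qed.

Lemma cons_indexS k c (a : multiindex n k) s : cons_index c a (lift ord0 s) = a s.
Proof. by rewrite ffunE liftK. Qed.

Lemma tail_cons k c (a : multiindex n k) : tail_index (cons_index c a) = a.
Proof. by apply/ffunP => s; rewrite ffunE cons_indexS. Qed.

(** The predicate P allows for slots to be left out, as happens for traces. *)
Definition exponent k (P : pred 'I_k) (a : multiindex n k) : multinom n :=
  \big[mnm_add/mnm0 (n := n)]_(s < k | P s) mnm1 (a s).

Definition mnm_fact (mu : multinom n) : nat := (\prod_(i < n) (mu i)`!)%N.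

Lemma exponentE k (P : pred 'I_k) (a : multiindex n k) i :
  exponent P a i = (\sum_(s < k | P s) (a s == i))%N.
Proof. by rewrite mnm_sumE; apply: eq_bigr => s _; rewrite mnm1E. Qed.

Lemma exponentD1 k (P : pred 'I_k) (a : multiindex n k) p : P p ->
  exponent P a = mnm_add (mnm1 (a p)) (exponent [pred s | P s & s != p] a).
Proof.
by move=> Pp; apply/mnmP => i; rewrite mnmDE !exponentE (bigD1 p) //= mnm1E.
Qed.

Lemma eq_exponent k (P Q : pred 'I_k) (a b : multiindex n k) :
  P =1 Q -> (forall s, P s -> a s = b s) -> exponent P a = exponent Q b.
Proof.
move=> PQ ab; apply/mnmP => i; rewrite !exponentE.
by apply: eq_big => // s /ab ->.
Qed.

Lemma mnm_factU mu c :
  mnm_fact (mnm_add (mnm1 c) mu) = (mnm_fact mu * (mu c).+1)%N.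
Proof.
rewrite /mnm_fact (bigD1 c) //= [in RHS](bigD1 c) //= mnmDE mnm1E eqxx add1n factS.
rewrite [RHS]mulnC mulnA; congr (_ * _)%N.
by apply: eq_bigr => i ic; rewrite mnmDE mnm1E eq_sym (negbTE ic).
Qed.

Lemma mnm_fact_gt0 mu : (0 < mnm_fact mu)%N.
Proof. by apply: prodn_gt0 => i; exact: fact_gt0. Qed.

Lemma mnm_addC (mu nu : multinom n) : mnm_add mu nu = mnm_add nu mu.
Proof. by apply/mnmP => i; rewrite !mnmDE addnC. Qed.

Lemma mnm_add_inj (mu : multinom n) : injective (mnm_add mu).
Proof. by move=> nu rho /mnmP e; apply/mnmP => i; have := e i; rewrite !mnmDE => /addnI. Qed.

Lemma exponent_perm k (a : multiindex n k) (s : 'S_k) :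
  exponent predT (perm_index a s) = exponent predT a.
Proof.
apply/mnmP => i; rewrite !exponentE [RHS](reindex_inj (@perm_inj _ s)) /=.
by apply: eq_bigr => t _; rewrite ffunE.
Qed.

Lemma exponent_cons k c (a : multiindex n k) :
  exponent predT (cons_index c a) = mnm_add (mnm1 c) (exponent predT a).
Proof.
apply/mnmP => i; rewrite mnmDE !exponentE big_ord_recl ffunE unlift_none mnm1E.
by congr (_ + _)%N; apply: eq_bigr => s _; rewrite ffunE liftK.
Qed.

Lemma exponent_surj k (mu : multinom n) : mdeg mu = k ->
  exists a : multiindex n k, exponent predT a = mu.
Proof.
elim: k mu => [|k IH] mu.
  move=> /eqP; rewrite mdeg_eq0 => /eqP ->.
  exists (finfun (fun i : 'I_0 => match i with Ordinal _ h => False_rect _ (notF h) end)).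
  by apply/mnmP => i; rewrite exponentE big_ord0 mnm0E.
move=> muk; have [c mu_c] : exists c, (0 < mu c)%N.
  apply: contra_eqP muk => /forallNP mu0; rewrite (_ : mu = mnm0 (n := n)) ?mdeg0 //.
  by apply/mnmP => i; rewrite mnm0E; have /negP := mu0 i; rewrite lt0n negbK => /eqP.
have e := mnm_predK mu_c.
have [|a ae] := IH (mnm_sub mu (mnm1 c)).
  by move: muk; rewrite -{1}e mdegD mdeg1 add1n => -[].
by exists (cons_index c a); rewrite exponent_cons ae e.
Qed.

(** The rearrangements of a into b, if any, form a torsor under the stabilizer of
    a, a product of symmetric groups.  The induction follows the expansion of a
    permanent along its first row. *)
Lemma count_perm_index k (a b : multiindex n k) :
  (\sum_(s : 'S_k) (perm_index a s == b) =
  (exponent predT a == exponent predT b) * mnm_fact (exponent predT a))%N.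
Proof.
elim: k a b => [|k IH] a b.
  have e0 (c d : multiindex n 0) : c = d by apply/ffunP => -[].
  have z (c : multiindex n 0) : exponent predT c = mnm0 (n := n).
    by apply/mnmP => i; rewrite exponentE big_ord0 mnm0E.
  rewrite !z eqxx mul1n /mnm_fact [RHS]big1 => [|i _]; last by rewrite mnm0E.
  rewrite (eq_bigr (fun=> 1%N)) => [|s _]; last by rewrite (e0 (perm_index a s) b) eqxx.
  by rewrite sum1_card card_Sn.
pose del (j : 'I_k.+1) := [ffun t : 'I_k => a (lift j t)] : multiindex n k.
have expa j : exponent predT a = mnm_add (mnm1 (a j)) (exponent predT (del j)).
  apply/mnmP => i; rewrite mnmDE !exponentE (bigD1 j) //= mnm1E; congr (_ + _)%N.
  rewrite (reindex_omap (lift j) (unlift j)) /=; last first.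
    by by move=> t /negPf tj; case: unliftP => [t' ->|e] //; rewrite e eqxx in tj.
  apply: eq_big => [t|t _]; first by rewrite liftK eqxx andbT eq_sym neq_lift.
  by rewrite ffunE.
have expb : exponent predT b = mnm_add (mnm1 (b ord0)) (exponent predT (tail_index b)).
  rewrite -exponent_cons; congr exponent; apply/ffunP => t; rewrite ffunE.
  by case: unliftP => [t'|] ->; rewrite ?ffunE.
(* The permutation sends the first slot to j, and the others to a permutation of
   the remaining slots. *)
rewrite big_perm_recl.
under eq_bigr => j _.
  under eq_bigr => s _.
    rewrite (_ : (perm_index a (lift_perm ord0 j s) == b) =
        (a j == b ord0) && (perm_index (del j) s == tail_index b)); last first.
      apply/eqP/andP.
        move=> /ffunP e; split; first by have := e ord0; rewrite ffunE lift_perm_id => ->.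
        apply/eqP/ffunP => t; have := e (lift ord0 t).
        by rewrite !ffunE lift_perm_lift.
      move=> [/eqP e0 /eqP/ffunP e]; apply/ffunP => t; rewrite ffunE.
      case: (unliftP ord0 t) => [t'|] ->; last by rewrite lift_perm_id.
      by have := e t'; rewrite !ffunE lift_perm_lift.
    rewrite -mulnb.
    over.
  rewrite -big_distrr /= IH.
  over.
rewrite [exponent predT b]expb.
case: eqVneq => [E|NE]; last first.
  rewrite /= mul0n big1 // => j _; case: (eqVneq (a j) (b ord0)) => [ab|];
    rewrite ?mul0n // /= mul1n.
  case: eqVneq => [E|]; rewrite ?mul0n //.
  by case/eqP: NE; rewrite (expa j) ab E.
rewrite /= mul1n (eq_bigr (fun j => (a j == b ord0) * mnm_fact (exponent predT (tail_index b)))%N).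
  rewrite -big_distrl /= -exponentE E mnm_factU mulnC; congr (_ * _)%N.
  by rewrite mnmDE mnm1E eqxx.
move=> j _; case: (eqVneq (a j) (b ord0)) => [ab|_]; rewrite ?mul0n // /= !mul1n.
have -> : exponent predT (del j) = exponent predT (tail_index b).
  by apply: (@mnm_add_inj (mnm1 (b ord0))); rewrite -E (expa j) ab.
by rewrite eqxx /= mul1n.
Qed.
End Indices.

(** * Covariant tensors as polynomials *)

Section TensorPolynomial.
Context {R : realType} {n : nat}.
Implicit Types (g : 'M[R]_n) (F : mpoly n R).

Local Notation var c := (mpolyX R (mnm1 c) : mpoly n R).

Definition monom k (P : pred 'I_k) (a : multiindex n k) : mpoly n R :=
  \prod_(s < k | P s) var (a s).

Definition tensor_poly k (f : tens R n k) : mpoly n R := \sum_a f a *: monom predT a.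

(** The inverse of [tensor_poly] on symmetric tensors: the entry at a is 1/k! times the
    derivative of F along the coordinates listed by a, here read off from the
    coefficients. *)
Definition poly_tensor k F : tens R n k :=
  [ffun a : multiindex n k => (k`!%:R)^-1 *
    ((mnm_fact (exponent predT a))%:R * mcoeff (exponent predT a) F)].

Lemma monomE k (P : pred 'I_k) (a : multiindex n k) :
  monom P a = mpolyX R (exponent P a).
Proof. exact: mprodXE. Qed.

Lemma monom_cons k c (a : multiindex n k) :
  monom predT (cons_index c a) = var c * monom predT a.
Proof. by rewrite !monomE exponent_cons mpolyXD. Qed.

Lemma monomD1 k (P : pred 'I_k) (a : multiindex n k) s : P s ->
  monom P a = var (a s) * monom [pred t | P t & t != s] a.
Proof. by move=> Ps; rewrite /monom (bigD1 s). Qed.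

Lemma monom_upd k (P : pred 'I_k) (a : multiindex n k) s d : ~~ P s ->
  monom P (upd a s d) = monom P a.
Proof.
move=> Ps; apply: eq_bigr => t Pt; rewrite upd_other //.
by apply: contraNneq Ps => <-.
Qed.

Lemma exponent_upd k (P : pred 'I_k) (a : multiindex n k) s d : ~~ P s ->
  exponent P (upd a s d) = exponent P a.
Proof.
move=> Ps; apply: eq_exponent => // t Pt; rewrite upd_other //.
by apply: contraNneq Ps => <-.
Qed.

Lemma symmetrization_poly k (f : tens R n k) :
  poly_tensor k (tensor_poly f) = symmetrization f.
Proof.
apply/ffunP => a; rewrite !ffunE; congr (_ * _).
rewrite raddf_sum mulr_sumr /=.
under eq_bigr => b _.
  rewrite mcoeffZ monomE mcoeffX mulrCA [X in _ * X]mulrC -natrM eq_sym.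
  rewrite -count_perm_index natr_sum mulr_sumr.
  over.
rewrite exchange_big /=; apply: eq_bigr => s _.
rewrite (bigD1 (perm_index a s)) //= eqxx mulr1 big1 ?addr0 // => b.
by rewrite eq_sym => /negbTE ->; rewrite mulr0.
Qed.

Lemma tensor_poly_symmetrization k (f : tens R n k) :
  tensor_poly (symmetrization f) = tensor_poly f.
Proof.
have k0 : k`!%:R != 0 :> R by rewrite pnatr_eq0 -lt0n fact_gt0.
rewrite /tensor_poly; under eq_bigr => a _ do rewrite ffunE -scalerA scaler_suml.
rewrite -scaler_sumr exchange_big /=.
rewrite (eq_bigr (fun=> tensor_poly f)) => [|s _].
  by rewrite sumr_const card_Sn -[tensor_poly f *+ _]scaler_nat scalerA mulVf // scale1r.
rewrite /tensor_poly [RHS](reindex_inj (_ : injective (@perm_index n k ^~ s))) /=.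
  by apply: eq_bigr => a _; rewrite !monomE exponent_perm.
move=> a b /ffunP e; apply/ffunP => t; have := e (s^-1 t)%g.
by rewrite !ffunE permKV.
Qed.

Lemma symmetrizationE k (f : tens R n k) : symmetric_tensor f -> symmetrization f = f.
Proof.
move=> fS; apply/ffunP => a; rewrite ffunE.
under eq_bigr do rewrite fS.
rewrite sumr_const card_Sn -[f a *+ _]mulr_natl mulrA mulVf ?mul1r //.
Qed.

Lemma poly_tensor_symmetric k F : symmetric_tensor (poly_tensor k F).
Proof. by move=> s a; rewrite !ffunE exponent_perm. Qed.

Lemma mdeg_exponent k (P : pred 'I_k) (a : multiindex n k) :
  mdeg (exponent P a) = #|P|.
Proof.
by rewrite mdeg_sum -sum1_card; apply: eq_bigr => s _; rewrite mdeg1.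
Qed.

Lemma euler_degreeX mu : euler_degree (mdeg mu)%:R (mpolyX R mu : mpoly n R).
Proof.
rewrite /euler_degree mdegE natr_sum scaler_suml; apply: eq_bigr => c _.
rewrite mderivX -scalerAr; have [->|c0] := posnP (mu c); first by rewrite !scale0r.
by rewrite -mpolyXD mnm_predK.
Qed.

Lemma euler_degree_tensor_poly k (f : tens R n k) : euler_degree k%:R (tensor_poly f).
Proof.
apply: euler_degree_sum => a _; apply: euler_degreeZ.
rewrite -[k in k%:R]card_ord monomE -(mdeg_exponent predT a); exact: euler_degreeX.
Qed.

Lemma tensor_polyD k (f h : tens R n k) : tensor_poly (f + h) = tensor_poly f + tensor_poly h.
Proof.
by rewrite /tensor_poly -big_split; apply: eq_bigr => a _; rewrite ffunE scalerDl.
Qed.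

Lemma tensor_poly_surj k F : euler_degree k%:R F -> exists f : tens R n k, tensor_poly f = F.
Proof.
move=> Fk; rewrite [F]mpolyE.
have : {in msupp F, forall mu, mdeg mu = k}.
  move=> mu muF; have /eqP := euler_degree_mcoeff mu Fk.
  rewrite -subr_eq0 -mulrBr mulf_eq0 subr_eq0 eqr_nat mcoeff_eq0 muF.
  by move=> /eqP.
elim: (msupp F) => [|mu r IH] rk.
  exists [ffun => 0]; rewrite big_nil /tensor_poly big1 // => a _.
  by rewrite ffunE scale0r.
have [|f fE] := IH; first by move=> nu nur; apply: rk; rewrite in_cons nur orbT.
have [a aE] := exponent_surj (rk mu (mem_head _ _)).
exists (f + [ffun b => mcoeff mu F * (a == b)%:R]).
rewrite tensor_polyD fE big_cons addrC; congr (_ + _).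
rewrite /tensor_poly (bigD1 a) //= ffunE eqxx mulr1 monomE aE big1 ?addr0 // => b.
by rewrite eq_sym ffunE => /negbTE ->; rewrite mulr0 scale0r.
Qed.

Lemma poly_tensorK k F : euler_degree k%:R F -> tensor_poly (poly_tensor k F) = F.
Proof.
move=> /tensor_poly_surj[f <-].
by rewrite symmetrization_poly tensor_poly_symmetrization.
Qed.

Lemma mnm_fact_mcoeff F mu c :
  (mnm_fact (mnm_add (mnm1 c) mu))%:R * mcoeff (mnm_add (mnm1 c) mu) F
  = (mnm_fact mu)%:R * mcoeff mu (mderiv c F).
Proof.
rewrite mcoeff_deriv mnm_factU natrM -mulrA; congr (_ * _).
by rewrite mulr_natl mnm_addC.
Qed.

(** Both sides are 1/k! times the derivative of F at the origin along c, d and the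
    entries of a outside p and q, summed against the inverse metric. *)
Lemma trace_poly_tensor k g F (p q : 'I_k) a : p != q ->
  \sum_(c < n) \sum_(d < n)
    invmx g c d * poly_tensor k F (set_index (set_index a p c) q d)
  = (k`!%:R)^-1 * ((mnm_fact (exponent [pred s | s != p & s != q] a))%:R
      * mcoeff (exponent [pred s | s != p & s != q] a) (laplacian g F)).
Proof.
move=> pq; rewrite /laplacian raddf_sum !mulr_sumr; apply: eq_bigr => c _.
rewrite raddf_sum !mulr_sumr /=; apply: eq_bigr => d _.
rewrite mcoeffZ ffunE mulrCA; congr (_ * _); rewrite [RHS]mulrCA; congr (_ * _).
set b := set_index _ q d.
have -> : exponent predT b = mnm_add (mnm1 c) (mnm_add (mnm1 d)
    (exponent [pred s | s != p & s != q] a)).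
  have bp : b p = c by rewrite !ffunE eqxx (negbTE pq).
  have bq : b q = d by rewrite ffunE eqxx.
  rewrite (@exponentD1 _ _ _ _ p) // bp; congr mnm_add.
  rewrite (@exponentD1 _ _ _ _ q) /= 1?eq_sym ?pq // bq; congr mnm_add.
  by apply: eq_exponent => // s /andP[sp sq]; rewrite !ffunE (negbTE sp) (negbTE sq).
by rewrite !mnm_fact_mcoeff.
Qed.

Lemma poly_tensor_trace_free k g F : laplacian g F = 0 -> trace_free g (poly_tensor k F).
Proof. by move=> F0 p q pq a; rewrite trace_poly_tensor // F0 mcoeff0 !mulr0. Qed.

(** The coefficients of the Laplacian are traces of f: every exponent of degree
    k - 2 comes from a multi-index of valence k with two slots kept for the trace. *)
Lemma laplacian_tensor_poly0 k g (f : tens R n k) : symmetric_tensor f -> trace_free g f ->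
  laplacian g (tensor_poly f) = 0.
Proof.
move=> fS ftr; have Dk := euler_degree_laplacian g (euler_degree_tensor_poly f).
case: k => [|[|k]] in f fS ftr Dk *; try by apply: (euler_degree_lt0 Dk); lra.
apply/mpolyP => mu; rewrite mcoeff0; apply/eqP/negPn/negP => mu0.
have muk : mdeg mu = k.
  have /eqP := euler_degree_mcoeff mu Dk.
  rewrite -subr_eq0 -mulrBr mulf_eq0 (negbTE mu0) /= subr_eq0.
  by rewrite -[k.+2]addn2 natrD addrK eqr_nat => /eqP.
have [a aE] := exponent_surj muk.
have [c0 _|no_c] := pickP 'I_n; last first.
  move: mu0; rewrite /laplacian big1 ?mcoeff0 ?eqxx // => c _; by have := no_c c.
pose b := cons_index c0 (cons_index c0 a).
have := ftr ord0 (lift ord0 ord0) isT b.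
rewrite -{1}(symmetrizationE fS) -symmetrization_poly trace_poly_tensor //.
have -> : exponent [pred s | s != ord0 & s != lift ord0 ord0] b = mu.
  rewrite -aE; have E : exponent predT b
      = mnm_add (mnm1 c0) (mnm_add (mnm1 c0) (exponent predT a)).
    by rewrite !exponent_cons.
  have b0 : b ord0 = c0 by rewrite ffunE unlift_none.
  have b1 : b (lift ord0 ord0) = c0 by rewrite !ffunE liftK ffunE unlift_none.
  move: E; rewrite (@exponentD1 _ _ _ _ ord0) // b0 => /mnm_add_inj.
  rewrite (@exponentD1 _ _ _ _ (lift ord0 ord0)) // b1 => /mnm_add_inj <-.
  exact: eq_exponent.
move/eqP; rewrite mulf_eq0 invr_eq0 mulf_eq0 !pnatr_eq0 (negbTE mu0) orbF.
by rewrite -!leqn0 leqNgt fact_gt0 leqNgt mnm_fact_gt0.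
Qed.

(** The derivative of X_c F along a at the origin, by the Leibniz rule. *)
Lemma mnm_fact_mcoeff_varM k (P : pred 'I_k) (a : multiindex n k) c F :
  (mnm_fact (exponent P a))%:R * mcoeff (exponent P a) (var c * F)
  = \sum_(p < k | P p) (a p == c)%:R *
      ((mnm_fact (exponent [pred s | P s & s != p] a))%:R
       * mcoeff (exponent [pred s | P s & s != p] a) F).
Proof.
set mu := exponent P a.
have muc : mu c = (\sum_(p < k | P p) (a p == c))%N by rewrite exponentE.
have [mu0|mu_gt0] := posnP (mu c).
  rewrite [X in _ * X](_ : _ = 0) ?mulr0; last first.
    rewrite mcoeffM big1 // => -[[d ?] [e ?]] /= /eqP E.
    rewrite mcoeffX; case: eqVneq => [ed|]; last by rewrite mul0r.
    by move: mu0; rewrite E mnmDE -ed mnm1E eqxx.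
  rewrite big1 // => p Pp; move/eqP: mu0; rewrite muc sum_nat_eq0.
  by move=> /forall_inP/(_ p Pp); rewrite eqb0 => /negbTE ->; rewrite mul0r.
pose nu := mnm_sub mu (mnm1 c).
have munu : mu = mnm_add (mnm1 c) nu by rewrite mnm_predK.
rewrite munu mnm_factU [var c * F]mulrC mcoeffMX natrM.
rewrite [(nu c).+1](_ : _ = mu c); last by rewrite munu mnmDE mnm1E eqxx.
rewrite muc natr_sum mulr_sumr mulr_suml; apply: eq_bigr => p Pp.
case: eqVneq => [ap|_]; last by rewrite mulr0 !mul0r.
rewrite mulr1 mul1r; have -> // : exponent [pred s | P s & s != p] a = nu.
by apply: (@mnm_add_inj _ (mnm1 c)); rewrite -munu /mu (exponentD1 _ Pp) ap.
Qed.

(** Differentiating g(X,X) q at the origin, two of the derivatives fall on the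
    quadric; the pairs {p, q} of slots that they come from are the summands of
    [pure_trace]. *)
Lemma poly_tensor_pure_trace k g q : g^T = g -> pure_trace g (poly_tensor k (quadric g * q)).
Proof.
move=> gS; pose P (p r : 'I_k) := [pred s | s != p & s != r].
pose w (p r : 'I_k) (a : multiindex n k) : R := (k`!%:R)^-1 *
  ((mnm_fact (exponent (P p r) a))%:R * mcoeff (exponent (P p r) a) q).
exists (fun p r => [ffun a => 2 * w p r a]); split.
  move=> p r a c; rewrite !ffunE /w; split; rewrite !(@exponent_upd _ (P p r) a) //;
  by rewrite /P /= eqxx ?andbF.
move=> a; rewrite ffunE /quadric mulr_suml raddf_sum !mulr_sumr /=.
have wS p r : w p r a = w r p a.
  rewrite /w; have -> // : exponent (P p r) a = exponent (P r p) a.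
  by apply: eq_exponent => // s; rewrite /= andbC.
transitivity (\sum_(p < k) \sum_(r < k | r != p) g (a p) (a r) * w p r a).
  transitivity (\sum_(c < n) \sum_(d < n) \sum_(p < k) \sum_(r < k | r != p)
     (a p == c)%:R * ((a r == d)%:R * (g c d * w p r a))).
    apply: eq_bigr => c _; rewrite mulr_suml raddf_sum !mulr_sumr /=.
    apply: eq_bigr => d _; rewrite -scalerAl mcoeffZ -mulrA.
    rewrite [X in _ * X]mulrCA mnm_fact_mcoeff_varM !mulr_sumr.
    apply: eq_bigr => p _; rewrite mnm_fact_mcoeff_varM !mulr_sumr.
    apply: eq_bigr => r rp; rewrite /w.
    have -> : exponent [pred s | [pred s0 | predT s0 & s0 != p] s & s != r] a
       = exponent (P p r) a by apply: eq_exponent.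
    by ring.
  under eq_bigr => c _ do rewrite exchange_big.
  rewrite exchange_big; apply: eq_bigr => p _ /=.
  under eq_bigr => c _ do rewrite exchange_big.
  rewrite exchange_big; apply: eq_bigr => r _ /=.
  rewrite (bigD1 (a p)) //= (bigD1 (a r)) //= !eqxx !mul1r.
  rewrite big1 ?addr0 => [|d /negbTE]; last by rewrite eq_sym => ->; rewrite mul0r mulr0.
  rewrite big1 ?addr0 // => c /negbTE; rewrite eq_sym => ->.
  by rewrite big1 // => d _; rewrite mul0r.
transitivity (\sum_(p < k) \sum_(r < k | (p < r)%N) g (a p) (a r) * w p r a
   + \sum_(p < k) \sum_(r < k | (r < p)%N) g (a p) (a r) * w p r a).
  rewrite -big_split; apply: eq_bigr => p _ /=.
  rewrite (bigID (fun r : 'I_k => (p < r)%N)) /=; congr (_ + _); apply: eq_bigl => r.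
    by rewrite -val_eqE /= neq_ltn; case: (ltngtP r p).
  by rewrite -val_eqE /= neq_ltn; case: (ltngtP r p).
rewrite [X in _ + X](exchange_big_dep predT) //= -big_split; apply: eq_bigr => p _ /=.
rewrite -big_split; apply: eq_bigr => r pr /=.
by rewrite wS (sym_mxE _ _ gS) !ffunE (wS r p); ring.
Qed.

(** Contracting each term g(a_p,a_q) u_{pq}(a) with X splits off g(X,X), as u_{pq} is
    independent of the slots p and q. *)
Lemma tensor_poly_pure_trace k g (f : tens R n k) : (0 < n)%N -> pure_trace g f ->
  exists2 q, euler_degree (k%:R - 2) q & tensor_poly f = quadric g * q.
Proof.
move=> n0 [u [uI fE]].
pose P (p r : 'I_k) := [pred s : 'I_k | (true && (s != p)) && (s != r)].
(* The n * n assignments of the slots p and q all count the same value of u. *)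
pose q p r := ((n * n)%:R)^-1 *: \sum_a u p r a *: monom (P p r) a.
have nn0 : (n * n)%:R != 0 :> R by rewrite pnatr_eq0 muln_eq0 orbb -lt0n.
have qE (p r : 'I_k) : (p < r)%N -> euler_degree (k%:R - 2) (q p r) /\
    \sum_(a : multiindex n k) (g (a p) (a r) * u p r a) *: monom predT a = quadric g * q p r.
  move=> pr; have rp : r != p by rewrite -val_eqE /= gtn_eqF.
  split.
    apply: euler_degreeZ; apply: euler_degree_sum => a _; apply: euler_degreeZ.
    have mk : (mdeg (exponent (P p r) a)).+2 = k.
      have := mdeg_exponent predT a; rewrite (@exponentD1 _ _ _ _ p) //.
      by rewrite (@exponentD1 _ _ _ _ r) //= !mdegD !mdeg1 cardT size_enum_ord.
    rewrite -[k in k%:R]mk -[_.+2]addn2 natrD addrK.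
    by rewrite monomE; exact: euler_degreeX.
  rewrite -scalerAr; apply: (@scalerI _ _ (n * n)%:R).
    exact: nn0.
  rewrite scalerA divff // scale1r.
  rewrite scaler_nat mulrnA -(sum_upd p) -(sum_upd r) mulr_sumr.
  apply: eq_bigr => a _; rewrite /quadric mulr_suml exchange_big.
  apply: eq_bigr => c _; rewrite mulr_suml; apply: eq_bigr => d _.
  have vp : upd (upd a r d) p c p = c by rewrite upd_same.
  have vr : upd (upd a r d) p c r = d by rewrite upd_other // upd_same.
  rewrite (monomD1 _ (s := p)) // (monomD1 _ (s := r)) //= vp vr.
  rewrite !monom_upd /= ?eqxx ?andbF //.
  have -> : u p r (upd (upd a r d) p c) = u p r a.
    have [-> _] := uI p r (upd a r d) c.
    by have [_ ->] := uI p r a d.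
  by rewrite -scalerAl -!scalerAr !scalerA !mulrA.
exists (\sum_(p < k) \sum_(r < k | (p < r)%N) q p r).
  by apply: euler_degree_sum => p _; apply: euler_degree_sum => r /qE[].
rewrite mulr_sumr /tensor_poly; under eq_bigr => a _ do rewrite fE scaler_suml.
rewrite exchange_big; apply: eq_bigr => p _ /=; rewrite mulr_sumr.
under eq_bigr => a _ do rewrite scaler_suml.
rewrite exchange_big; apply: eq_bigr => r pr /=.
by have [_ ->] := qE p r pr.
Qed.
End TensorPolynomial.

(** * The trace-free symmetric part of a tensor *)

Section TraceFreePart.
Context {R : realType} {n : nat}.
Implicit Types (g : 'M[R]_n) (F : mpoly n R).

Definition fischer_norm (k : nat) : R :=
  \prod_(i < k./2) @fischer_eigenvalue R n k%:R i.+1.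

Definition harmonic_part g k F : mpoly n R :=
  (fischer_norm k)^-1 *: fischer g k%:R k./2 F.

Definition harmonic_quotient g k F : mpoly n R :=
  (fischer_norm k)^-1 *: fischer_quotient g k%:R k./2 F.

Lemma fischer_norm_neq0 k : (0 < n)%N -> fischer_norm k != 0.
Proof.
move=> n0; apply/prodf_neq0 => i _; rewrite gt_eqF //.
by apply: fischer_eigenvalue_gt0 => //; have := ltn_ord i; lia.
Qed.

Lemma harmonic_partE g k F : (0 < n)%N ->
  harmonic_part g k F = F - quadric g * harmonic_quotient g k F.
Proof.
move=> n0; rewrite /harmonic_part fischer_divE scalerBr scalerA -/(fischer_norm k).
by rewrite mulVf ?fischer_norm_neq0 // scale1r scalerAr.
Qed.

Lemma euler_degree_harmonic_part g k F :
  euler_degree k%:R F -> euler_degree k%:R (harmonic_part g k F).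
Proof. by move=> Fk; exact/euler_degreeZ/euler_degree_fischer. Qed.

Lemma laplacian_harmonic_part g k F : g^T = g -> g \in unitmx ->
  euler_degree k%:R F -> laplacian g (harmonic_part g k F) = 0.
Proof.
move=> gS gU Fk; rewrite laplacianZ laplacian_fischer0 ?scaler0 //.
by apply: iter_laplacian0 Fk _; rewrite -natrM ltr_nat; lia.
Qed.

Lemma trace_freeB k g (f h : tens R n k) :
  trace_free g f -> trace_free g h -> trace_free g (f - h).
Proof.
move=> f0 h0 p q pq a; pose T (e : tens R n k) c d :=
  invmx g c d * e (set_index (set_index a p c) q d).
transitivity (\sum_c \sum_d T f c d - \sum_c \sum_d T h c d).
  rewrite -sumrB; apply: eq_bigr => c _; rewrite -sumrB; apply: eq_bigr => d _.
  by rewrite /T !ffunE mulrBr.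
by rewrite /T f0 // h0 // subr0.
Qed.

Lemma pure_traceB k g (f h : tens R n k) :
  pure_trace g f -> pure_trace g h -> pure_trace g (f - h).
Proof.
move=> [u [uI uE]] [v [vI vE]].
exists (fun p q => u p q - v p q); split.
  move=> p q a c; have [u1 u2] := uI p q a c; have [v1 v2] := vI p q a c.
  by rewrite !ffunE u1 u2 v1 v2.
move=> a; rewrite !ffunE uE vE -sumrB; apply: eq_bigr => p _.
by rewrite -sumrB; apply: eq_bigr => q _; rewrite !ffunE mulrBr.
Qed.

Lemma symmetric_tensorB k (f h : tens R n k) :
  symmetric_tensor f -> symmetric_tensor h -> symmetric_tensor (f - h).
Proof. by move=> fS hS s a; rewrite !ffunE fS hS. Qed.

(** A harmonic polynomial is multiplied by a nonzero constant by [fischer], while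
    a multiple of the quadric is annihilated.  This replaces positivity of the
    metric, so any signature is allowed. *)
Lemma trace_free_pure_trace0 k g (f : tens R n k) : (0 < n)%N ->
  g^T = g -> g \in unitmx ->
  symmetric_tensor f -> trace_free g f -> pure_trace g f -> f = 0.
Proof.
move=> n0 gS gU fS f0 /(tensor_poly_pure_trace n0)[q qk fE].
suff F0 : tensor_poly f = 0.
  by rewrite -(symmetrizationE fS) -symmetrization_poly F0; apply/ffunP => a;
     rewrite !ffunE mcoeff0 !mulr0.
have := fischer_harmonic k%:R k./2 (laplacian_tensor_poly0 fS f0).
rewrite {1}fE fischer_quadricM0 //; last first.
  by apply: (iter_laplacian0 _ qk); rewrite ltrBlDr -natrM -natrD ltr_nat; lia.
move=> /esym/eqP; rewrite scaler_eq0 => /orP[|/eqP //].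
by rewrite (negbTE (fischer_norm_neq0 k n0)).
Qed.

Lemma is_tf_sym_part_unique k g (f h1 h2 : tens R n k) : (0 < n)%N ->
  g^T = g -> g \in unitmx ->
  is_tf_sym_part g f h1 -> is_tf_sym_part g f h2 -> h1 = h2.
Proof.
move=> n0 gS gU [S1 [T1 P1]] [S2 [T2 P2]]; apply/eqP; rewrite -subr_eq0.
apply/eqP/(trace_free_pure_trace0 n0 gS gU).
- exact: symmetric_tensorB.
- exact: trace_freeB.
rewrite (_ : h1 - h2 = (symmetrization f - h2) - (symmetrization f - h1)).
  exact: pure_traceB.
by apply/ffunP => a; rewrite !ffunE; ring.
Qed.

(** An expression for [tf_sym_part] from which smoothness can be read off. *)
Definition tf_sym_formula k g (f : tens R n k) : tens R n k :=
  poly_tensor k (harmonic_part g k (tensor_poly f)).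

Lemma is_tf_sym_part_formula k g (f : tens R n k) : (0 < n)%N ->
  g^T = g -> g \in unitmx -> is_tf_sym_part g f (tf_sym_formula g f).
Proof.
move=> n0 gS gU; split; first exact: poly_tensor_symmetric.
split.
  exact/poly_tensor_trace_free/laplacian_harmonic_part/euler_degree_tensor_poly.
rewrite -symmetrization_poly.
rewrite (_ : _ - _ = poly_tensor k (quadric g * harmonic_quotient g k (tensor_poly f))).
  exact: poly_tensor_pure_trace.
apply/ffunP => a; rewrite !ffunE -mulrBr -mulrBr -mcoeffB harmonic_partE //.
by rewrite opprB addrC subrK.
Qed.

Lemma tf_sym_partP k g (f h : tens R n k) : (0 < n)%N ->
  g^T = g -> g \in unitmx -> is_tf_sym_part g f h -> tf_sym_part g f = h.
Proof.
move=> n0 gS gU fh; apply: xget_unique => // h'.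
by move=> fh'; apply: is_tf_sym_part_unique fh' fh.
Qed.

Lemma tf_sym_partE k g (f : tens R n k) : (0 < n)%N ->
  g^T = g -> g \in unitmx -> tf_sym_part g f = tf_sym_formula g f.
Proof. by move=> n0 gS gU; apply: tf_sym_partP => //; apply: is_tf_sym_part_formula. Qed.

Definition scale_tens k (c : R) (f : tens R n k) : tens R n k := [ffun a => c * f a].

Lemma scale_tensE k c (f : tens R n k) a : scale_tens c f a = c * f a.
Proof. by rewrite ffunE. Qed.

(** By uniqueness, as the pure traces and the trace-free tensors are the same for
    proportional metrics. *)
Lemma tf_sym_partZ k g (f : tens R n k) (l c : R) : (0 < n)%N ->
  g^T = g -> g \in unitmx -> l != 0 ->
  tf_sym_part (l *: g) (scale_tens c f) = scale_tens c (tf_sym_part g f).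
Proof.
move=> n0 gS gU l0; rewrite (tf_sym_partE _ n0 gS gU).
have lgU : l *: g \in unitmx by rewrite unitmxZ ?unitfE.
apply: tf_sym_partP => //; first by rewrite linearZ /= gS.
have [hS [h0 [u [uI uE]]]] := is_tf_sym_part_formula f n0 gS gU.
split; first by move=> s a; rewrite !scale_tensE hS.
split.
  move=> p q pq a; rewrite invmxZ //; transitivity (l^-1 * c * \sum_i \sum_j
      invmx g i j * tf_sym_formula g f (set_index (set_index a p i) q j)).
    rewrite mulr_sumr; apply: eq_bigr => i _; rewrite mulr_sumr.
    by apply: eq_bigr => j _; rewrite !mxE scale_tensE mulrACA.
  by rewrite h0 // mulr0.
exists (fun p q => scale_tens (l^-1 * c) (u p q)); split.
  move=> p q a i; have [u1 u2] := uI p q a i.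
  by rewrite !scale_tensE u1 u2.
move=> a; transitivity (c * (symmetrization f - tf_sym_formula g f) a).
  rewrite ![(_ - _ : tens _ _ _) a]ffunE ![(- _ : tens _ _ _) a]ffunE scale_tensE.
  rewrite mulrBr; congr (_ - _); rewrite !ffunE mulrCA; congr (_ * _).
  by rewrite mulr_sumr; apply: eq_bigr => s _; rewrite ffunE.
rewrite uE mulr_sumr; apply: eq_bigr => p _; rewrite mulr_sumr; apply: eq_bigr => q _.
by rewrite scale_tensE mxE; field.
Qed.

Definition pullback k (J : 'M[R]_n) (f : tens R n k) : tens R n k :=
  [ffun a : multiindex n k =>
    \sum_(b : multiindex n k) (\prod_s J (b s) (a s)) * f b].

Lemma sum_upd2 (V : nmodType) (I : finType) p q (F : {ffun I -> 'I_n} -> V) :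
  \sum_a \sum_c \sum_d F (upd (upd a p c) q d) = (\sum_a F a) *+ (n * n).
Proof.
rewrite mulrnA -(sum_upd q) -(sum_upd p).
by apply: eq_bigr => a _; apply: eq_bigr => c _.
Qed.

Lemma symmetrization_pullback k J (f : tens R n k) :
  symmetrization (pullback J f) = pullback J (symmetrization f).
Proof.
apply/ffunP => a; rewrite !ffunE.
under [RHS]eq_bigr do rewrite ffunE mulrCA mulr_sumr.
rewrite -mulr_sumr exchange_big; congr (_ * _); apply: eq_bigr => s _ /=.
rewrite ffunE (reindex_inj (_ : injective (@perm_index n k ^~ s))) /=; last first.
  move=> b c /ffunP e; apply/ffunP => t; have := e (s^-1 t)%g.
  by rewrite !ffunE permKV.
apply: eq_bigr => b _; congr (_ * _).
rewrite [RHS](reindex_inj (@perm_inj _ s)); apply: eq_bigr => t _.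
by rewrite !ffunE.
Qed.

Lemma pullback_symmetric k J (f : tens R n k) :
  symmetric_tensor f -> symmetric_tensor (pullback J f).
Proof.
move=> fS; rewrite -(symmetrizationE fS) -symmetrization_pullback -symmetrization_poly.
exact: poly_tensor_symmetric.
Qed.

Lemma prod2D1 (I : finType) (p q : I) (G : I -> R) : q != p ->
  \prod_s G s = G p * (G q * \prod_(s | (s != p) && (s != q)) G s).
Proof. by move=> qp; rewrite (bigD1 p) //= (bigD1 q). Qed.

Lemma prod_upd2 k (P : pred 'I_k) (H : 'I_n -> 'I_k -> R) a p q c d :
  ~~ P p -> ~~ P q ->
  \prod_(s | P s) H (upd (upd a p c) q d s) s = \prod_(s | P s) H (a s) s.
Proof.
move=> Pp Pq; apply: eq_bigr => s Ps; rewrite !upd_other //.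
  by apply: contraNneq Pp => <-.
by apply: contraNneq Pq => <-.
Qed.

(** The inverse metric is contravariant. *)
Lemma pullback_invmx (J g : 'M[R]_n) : J \in unitmx -> g \in unitmx ->
  J *m invmx (J^T *m g *m J) *m J^T = invmx g.
Proof.
move=> JU gU.
have g'U : J^T *m g *m J \in unitmx by rewrite !unitmx_mul unitmx_tr JU gU.
apply: (can_inj (mulmxK gU)); apply: (can_inj (mulmxK JU)).
by rewrite mulVmx // mul1mx -!mulmxA (mulmxA J^T) mulVmx // mulmx1.
Qed.

Lemma pullback_trace_free k J g (f : tens R n k) : (0 < n)%N ->
  J \in unitmx -> g \in unitmx ->
  trace_free g f -> trace_free (J^T *m g *m J) (pullback J f).
Proof.
move=> n0 JU gU f0 p q pq a; have qp : q != p by rewrite eq_sym.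
have nn0 : (n * n)%:R != 0 :> R by rewrite pnatr_eq0 muln_eq0 orbb -lt0n.
have invE := pullback_invmx JU gU.
pose P s := (s != p) && (s != q).
pose W (b : multiindex n k) := (\prod_(s | P s) J (b s) (a s)).
transitivity (\sum_(b : multiindex n k) W b * (invmx g (b p) (b q) * f b)).
  under eq_bigr => c _ do under eq_bigr => d _ do rewrite ffunE mulr_sumr.
  under eq_bigr => c _ do rewrite exchange_big.
  rewrite exchange_big; apply: eq_bigr => b _ /=.
  rewrite -invE !mxE mulr_suml mulr_sumr exchange_big; apply: eq_bigr => d _ /=.
  rewrite !mxE !mulr_suml mulr_sumr; apply: eq_bigr => c _.
  rewrite (prod2D1 _ qp) !ffunE eqxx (negbTE pq) eqxx.
  rewrite [X in _ * (_ * (_ * X) * _)](_ : _ = W b); first by ring.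
  by apply: eq_bigr => s /andP[/negbTE sp /negbTE sq]; rewrite !ffunE sq sp.
apply: (mulfI nn0); rewrite mulr0 mulr_natl -(sum_upd2 p q).
rewrite big1 // => b _; transitivity (W b * \sum_c \sum_d
    invmx g c d * f (set_index (set_index b p c) q d)); last by rewrite f0 // mulr0.
rewrite mulr_sumr; apply: eq_bigr => c _; rewrite mulr_sumr; apply: eq_bigr => d _.
rewrite /W (prod_upd2 (P := P) (fun i s => J i (a s))) /P ?eqxx ?andbF //.
by rewrite upd_same upd_other // upd_same.
Qed.

Lemma pullback_pure_trace k J g (f : tens R n k) : (0 < n)%N ->
  pure_trace g f -> pure_trace (J^T *m g *m J) (pullback J f).
Proof.
move=> n0 [u [uI uE]].
have nn0 : (n * n)%:R != 0 :> R by rewrite pnatr_eq0 muln_eq0 orbb -lt0n.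
pose P (p q s : 'I_k) := (s != p) && (s != q).
pose W p q (a b : multiindex n k) := (\prod_(s | P p q s) J (b s) (a s)).
exists (fun p q => [ffun a =>
  (n * n)%:R^-1 * \sum_(b : multiindex n k) W p q a b * u p q b]); split.
  move=> p q a c; rewrite !ffunE; split; congr (_ * _); apply: eq_bigr => b _;
    congr (_ * _); apply: eq_bigr => s /andP[/negbTE sp /negbTE sq];
    by rewrite ffunE ?sp ?sq.
move=> a; rewrite ffunE; under eq_bigr => b _ do rewrite uE mulr_sumr.
rewrite exchange_big; apply: eq_bigr => p _ /=.
under eq_bigr => b _ do rewrite mulr_sumr.
rewrite exchange_big; apply: eq_bigr => q pq /=.
have qp : q != p by rewrite -val_eqE /= gtn_eqF.
rewrite ffunE; apply: (mulfI nn0); rewrite [RHS]mulrCA mulVKf // mulr_natl.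
rewrite -(sum_upd2 p q) mulr_sumr; apply: eq_bigr => b _.
rewrite !mxE mulr_suml exchange_big; apply: eq_bigr => d _ /=.
rewrite !mxE !mulr_suml; apply: eq_bigr => c _.
have bp : upd (upd b p c) q d p = c by rewrite upd_other 1?eq_sym // upd_same.
rewrite (prod2D1 _ qp) bp upd_same !mxE.
rewrite (prod_upd2 (fun i s => J i (a s))) ?eqxx ?andbF // -/(W p q a b).
have [_ ->] := uI p q (upd b p c) d; have [-> _] := uI p q b c.
by ring.
Qed.

(** By uniqueness, as pulling back preserves all the conditions that characterize
    the trace-free symmetric part. *)
Lemma tf_sym_part_pullback k J g (f : tens R n k) : (0 < n)%N ->
  g^T = g -> g \in unitmx -> J \in unitmx ->
  tf_sym_part (J^T *m g *m J) (pullback J f) = pullback J (tf_sym_part g f).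
Proof.
move=> n0 gS gU JU; rewrite (tf_sym_partE _ n0 gS gU).
apply: tf_sym_partP => //.
- by rewrite !trmx_mul gS trmxK mulmxA.
- by rewrite !unitmx_mul unitmx_tr JU gU.
have [hS [h0 hP]] := is_tf_sym_part_formula f n0 gS gU.
split; first exact: pullback_symmetric.
split; first exact: pullback_trace_free.
rewrite symmetrization_pullback.
rewrite (_ : _ - _ = pullback J (symmetrization f - tf_sym_formula g f)).
  exact: pullback_pure_trace.
apply/ffunP => a; rewrite !ffunE -sumrB; apply: eq_bigr => b _.
by rewrite !ffunE mulrBr.
Qed.
End TraceFreePart.

(** * Smooth functions on an open set *)

Section SmoothFunctions.
Local Open Scope classical_set_scope.
Local Open Scope ring_scope.
Context {R : realType} {n : nat}.
Variable U : set 'rV[R]_n.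
Hypothesis U_open : open U.
Implicit Types (f h : 'rV[R]_n -> R).

Local Notation e_ i := (delta_mx 0 i : 'rV[R]_n).

Lemma near_eq_on f h x : U x -> (forall y, U y -> f y = h y) ->
  \forall y \near x, f y = h y.
Proof.
move=> Ux fh; have : nbhs x U by exact: open_nbhs_nbhs.
by apply: filterS => y /fh.
Qed.

(** [Ck] only sees germs at the points of the open set U. *)
Lemma Ck_eq k f h : (forall x, U x -> f x = h x) -> Ck k U f -> Ck k U h.
Proof.
elim: k f h => [|k IH] f h fh [fc fk]; split => //.
- move=> x Ux; have near_fh := near_eq_on Ux fh; rewrite /prop_for /continuous_at.
  rewrite -(fh x Ux); apply: cvg_trans (fc x Ux).
  exact: near_eq_cvg near_fh.
- move=> x Ux; have near_fh := near_eq_on Ux fh; rewrite /prop_for /continuous_at.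
  rewrite -(fh x Ux); apply: cvg_trans (fc x Ux).
  exact: near_eq_cvg near_fh.
move=> i; have [fd fp] := fk i; split.
  move=> x Ux; exact: near_eq_derivable (near_eq_on Ux fh) (fd x Ux).
apply: IH fp => x Ux; exact: near_eq_derive (near_eq_on Ux fh).
Qed.

Lemma CkW k f : Ck k.+1 U f -> Ck k U f.
Proof.
elim: k f => [|k IH] f [fc fk]; first by split.
by split => // i; have [fd fp] := fk i; split => //; exact: IH.
Qed.

Lemma Ck_cst k c : Ck k U (fun=> c).
Proof.
elim: k c => [|k IH] c; split=> //; first by move=> x _; exact: cst_continuous.
  by move=> x _; exact: cst_continuous.
move=> i; split; first by move=> x _.
apply: Ck_eq (IH 0) => x _; rewrite /partial; apply/esym.
exact: (@derive_val _ _ _ _ _ _ _ (is_derive_cst c x (e_ i))).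
Qed.

Lemma CkD k f h : Ck k U f -> Ck k U h -> Ck k U (f \+ h).
Proof.
elim: k f h => [|k IH] f h [fc fk] [hc hk]; split=> //;
  try by move=> x Ux; exact: continuousD (fc x Ux) (hc x Ux).
move=> i; have [fd fp] := fk i; have [hd hp] := hk i; split.
  by move=> x Ux; exact: derivableD (fd x Ux) (hd x Ux).
apply: Ck_eq (IH _ _ fp hp) => x Ux; rewrite /partial.
by rewrite (deriveD (fd x Ux) (hd x Ux)).
Qed.

Lemma CkM k f h : Ck k U f -> Ck k U h -> Ck k U (f \* h).
Proof.
elim: k f h => [|k IH] f h fS hS; have [fc fk] := fS; have [hc hk] := hS; split=> //;
  try by move=> x Ux; exact: continuousM (fc x Ux) (hc x Ux).
move=> i; have [fd fp] := fk i; have [hd hp] := hk i; split.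
  by move=> x Ux; exact: derivableM (fd x Ux) (hd x Ux).
have fkS := CkW fS; have hkS := CkW hS.
apply: Ck_eq (CkD (IH _ _ fkS hp) (IH _ _ hkS fp)) => x Ux; rewrite /partial.
by rewrite (deriveM (fd x Ux) (hd x Ux)).
Qed.

Lemma CkV k f : (forall x, U x -> f x != 0) -> Ck k U f -> Ck k U (fun x => (f x)^-1).
Proof.
move=> f0; elim: k => [|k IH] fS; have [fc fk] := fS; split=> //;
  try by move=> x Ux; exact: (continuousV (f0 x Ux) (fc x Ux)).
move=> i; have [fd fp] := fk i; split.
  by move=> x Ux; exact: (derivableV (f0 x Ux) (fd x Ux)).
have fV := IH (CkW fS).
apply: Ck_eq (CkM (CkM (Ck_cst k (-1)) (CkM fV fV)) fp) => x Ux; rewrite /partial.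
rewrite (deriveV (f0 x Ux) (fd x Ux)) /GRing.scale /= mulN1r -invfM expr2.
by rewrite invfM.
Qed.

Lemma smooth_on_eq f h : (forall x, U x -> f x = h x) -> smooth_on U f -> smooth_on U h.
Proof. by move=> fh fS k; apply: Ck_eq fh (fS k). Qed.

Lemma smooth_on_cst c : smooth_on U (fun=> c).
Proof. by move=> k; exact: Ck_cst. Qed.

Lemma smooth_onD f h : smooth_on U f -> smooth_on U h -> smooth_on U (fun x => f x + h x).
Proof. by move=> fS hS k; exact: CkD. Qed.

Lemma smooth_onM f h : smooth_on U f -> smooth_on U h -> smooth_on U (fun x => f x * h x).
Proof. by move=> fS hS k; exact: CkM. Qed.

Lemma smooth_onV f : (forall x, U x -> f x != 0) -> smooth_on U f ->
  smooth_on U (fun x => (f x)^-1).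
Proof. by move=> f0 fS k; exact: CkV. Qed.

Lemma smooth_on_sum (I : Type) (r : seq I) (P : pred I) (F : I -> 'rV[R]_n -> R) :
  (forall i, P i -> smooth_on U (F i)) ->
  smooth_on U (fun x => \sum_(i <- r | P i) F i x).
Proof.
move=> FS; elim: r => [|i r IH].
  by apply: smooth_on_eq (smooth_on_cst 0) => x _; rewrite big_nil.
case Pi : (P i); last by apply: smooth_on_eq IH => x _; rewrite big_cons Pi.
by apply: smooth_on_eq (smooth_onD (FS i Pi) IH) => x _; rewrite big_cons Pi.
Qed.

Lemma smooth_on_prod (I : Type) (r : seq I) (P : pred I) (F : I -> 'rV[R]_n -> R) :
  (forall i, P i -> smooth_on U (F i)) ->
  smooth_on U (fun x => \prod_(i <- r | P i) F i x).
Proof.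
move=> FS; elim: r => [|i r IH].
  by apply: smooth_on_eq (smooth_on_cst 1) => x _; rewrite big_nil.
case Pi : (P i); last by apply: smooth_on_eq IH => x _; rewrite big_cons Pi.
by apply: smooth_on_eq (smooth_onM (FS i Pi) IH) => x _; rewrite big_cons Pi.
Qed.

Lemma smooth_on_det k (A : 'rV[R]_n -> 'M[R]_k) :
  (forall i j, smooth_on U (fun x => A x i j)) -> smooth_on U (fun x => \det (A x)).
Proof.
move=> AS; apply: smooth_on_sum => s _; apply: smooth_onM; first exact: smooth_on_cst.
by apply: smooth_on_prod => i _; exact: AS.
Qed.

(** Cramer's rule. *)
Lemma smooth_on_invmx k (A : 'rV[R]_n -> 'M[R]_k) :
  (forall x, U x -> A x \in unitmx) ->
  (forall i j, smooth_on U (fun x => A x i j)) ->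
  forall i j, smooth_on U (fun x => invmx (A x) i j).
Proof.
move=> AU AS i j.
apply: (@smooth_on_eq (fun x => (\det (A x))^-1 *
   ((-1) ^+ (j + i) * \det (row' j (col' i (A x)))))).
  by move=> x Ux; rewrite /invmx AU // !mxE.
apply: smooth_onM.
  apply: smooth_onV; last exact: smooth_on_det.
  by move=> x /AU; rewrite unitmxE unitfE.
apply: smooth_onM; first exact: smooth_on_cst.
by apply: smooth_on_det => a b; apply: smooth_on_eq (AS (lift j a) (lift i b)) => x _; rewrite !mxE.
Qed.

Lemma smooth_on_is_derive f x i : U x -> smooth_on U f ->
  is_derive x (e_ i) f (partial i f x).
Proof. by move=> Ux /(_ 1%N)[_ /(_ i)[fd _]]; exact/derivableP/fd. Qed.
End SmoothFunctions.

(** * Families of polynomials and derivation along a spray *)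

Section SmoothFamily.
Local Open Scope classical_set_scope.
Local Open Scope ring_scope.
Context {R : realType} {n : nat}.
Variable U : set 'rV[R]_n.
Hypothesis U_open : open U.

Local Notation var c := (mpolyX R (mnm1 c) : mpoly n R).
Local Notation e_ i := (delta_mx 0 i : 'rV[R]_n).

(** Finite combinations of fixed polynomials with smooth coefficients.  Finiteness
    is what makes the coefficientwise derivative a polynomial again. *)
Inductive smooth_family : ('rV[R]_n -> mpoly n R) -> Prop :=
| smooth_family_scale f p : smooth_on U f -> smooth_family (fun x => f x *: p)
| smooth_familyD P Q : smooth_family P -> smooth_family Q ->
    smooth_family (fun x => P x + Q x)
| smooth_family_eq P Q : (forall x, U x -> P x = Q x) ->
    smooth_family P -> smooth_family Q.

Lemma smooth_family_cst p : smooth_family (fun=> p).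
Proof.
apply: smooth_family_eq (smooth_family_scale p (smooth_on_cst U_open 1)) => x _.
by rewrite scale1r.
Qed.

Lemma smooth_familyZ f P : smooth_on U f -> smooth_family P ->
  smooth_family (fun x => f x *: P x).
Proof.
move=> fS; elim=> {P} [h p hS|P Q _ PS _ QS|P Q PQ _ PS].
- apply: smooth_family_eq (smooth_family_scale p (smooth_onM U_open fS hS)) => x _.
  by rewrite scalerA.
- by apply: smooth_family_eq (smooth_familyD PS QS) => x _; rewrite scalerDr.
- by apply: smooth_family_eq PS => x Ux; rewrite PQ.
Qed.

Lemma smooth_family_linear (L : {linear mpoly n R -> mpoly n R}) P :
  smooth_family P -> smooth_family (fun x => L (P x)).
Proof.
elim=> {P} [h p hS|P Q _ PS _ QS|P Q PQ _ PS].
- by apply: smooth_family_eq (smooth_family_scale (L p) hS) => x _; rewrite linearZ.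
- by apply: smooth_family_eq (smooth_familyD PS QS) => x _; rewrite linearD.
- by apply: smooth_family_eq PS => x Ux; rewrite PQ.
Qed.

Lemma smooth_family_mderiv i P : smooth_family P ->
  smooth_family (fun x => mderiv i (P x)).
Proof. exact: smooth_family_linear. Qed.

Lemma smooth_familyM P Q : smooth_family P -> smooth_family Q ->
  smooth_family (fun x => P x * Q x).
Proof.
move=> PS QS; elim: PS => {P} [h p hS|P P' _ PS _ P'S|P P' PP' _ PS].
- elim: QS => {Q} [f q fS|Q Q' _ QS _ Q'S|Q Q' QQ' _ QS].
  + have hfS := smooth_onM U_open hS fS.
    apply: smooth_family_eq (smooth_family_scale (p * q) hfS) => x _.
    by rewrite -scalerAl -scalerAr scalerA.
  + by apply: smooth_family_eq (smooth_familyD QS Q'S) => x _; rewrite mulrDr.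
  + by apply: smooth_family_eq QS => x Ux; rewrite QQ'.
- by apply: smooth_family_eq (smooth_familyD PS P'S) => x _; rewrite mulrDl.
- by apply: smooth_family_eq PS => x Ux; rewrite PP'.
Qed.

Lemma smooth_family_sum (I : Type) (r : seq I) (A : pred I)
    (P : I -> 'rV[R]_n -> mpoly n R) : (forall i, A i -> smooth_family (P i)) ->
  smooth_family (fun x => \sum_(i <- r | A i) P i x).
Proof.
move=> PS; elim: r => [|i r IH].
  by apply: smooth_family_eq (smooth_family_cst 0) => x _; rewrite big_nil.
case Ai : (A i); last by apply: smooth_family_eq IH => x _; rewrite big_cons Ai.
by apply: smooth_family_eq (smooth_familyD (PS i Ai) IH) => x _; rewrite big_cons Ai.
Qed.

Lemma smooth_on_mcoeff mu P : smooth_family P -> smooth_on U (fun x => mcoeff mu (P x)).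
Proof.
elim=> {P} [h p hS|P Q _ PS _ QS|P Q PQ _ PS].
- apply: smooth_on_eq (smooth_onM U_open hS (smooth_on_cst U_open (mcoeff mu p))) => // x _.
  by rewrite mcoeffZ.
- by apply: smooth_on_eq (smooth_onD U_open PS QS) => // x _; rewrite mcoeffD.
- by apply: smooth_on_eq PS => // x Ux; rewrite PQ.
Qed.

Section Metric.
Variable g : 'rV[R]_n -> 'M[R]_n.
Hypothesis gU : forall x, U x -> g x \in unitmx.
Hypothesis g_smooth : forall a b, smooth_on U (fun x => g x a b).

Lemma smooth_family_quadric : smooth_family (fun x => quadric (g x)).
Proof.
apply: smooth_family_sum => c _; apply: smooth_family_sum => d _.
exact: smooth_family_scale.
Qed.

Lemma smooth_family_laplacian P : smooth_family P ->
  smooth_family (fun x => laplacian (g x) (P x)).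
Proof.
move=> PS; apply: smooth_family_sum => c _; apply: smooth_family_sum => d _.
apply: smooth_familyZ; first exact: smooth_on_invmx.
by do 2!apply: smooth_family_mderiv.
Qed.

Lemma smooth_family_fischer k j P : smooth_family P ->
  smooth_family (fun x => fischer (g x) k j (P x)).
Proof.
move=> PS; elim: j => //= j IH.
apply: smooth_family_eq (smooth_familyD
  (smooth_familyZ (smooth_on_cst U_open (fischer_eigenvalue k j.+1)) IH)
  (smooth_familyZ (smooth_on_cst U_open (-1))
    (smooth_familyM smooth_family_quadric (smooth_family_laplacian IH)))) => x _.
by rewrite scaleN1r.
Qed.

Lemma smooth_family_harmonic_quotient k P : smooth_family P ->
  smooth_family (fun x => harmonic_quotient (g x) k (P x)).
Proof.
move=> PS; apply: smooth_familyZ; first exact: smooth_on_cst.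
elim: k./2 => [|j IH] /=; first exact: smooth_family_cst.
apply: smooth_familyD; first by apply: smooth_familyZ => //; exact: smooth_on_cst.
exact/smooth_family_laplacian/smooth_family_fischer.
Qed.

Lemma smooth_family_harmonic_part k P : smooth_family P ->
  smooth_family (fun x => harmonic_part (g x) k (P x)).
Proof.
move=> PS; apply: smooth_familyZ; first exact: smooth_on_cst.
exact: smooth_family_fischer.
Qed.

Lemma smooth_family_tensor_poly k (f : 'rV[R]_n -> tens R n k) :
  (forall a, smooth_on U (fun x => f x a)) -> smooth_family (fun x => tensor_poly (f x)).
Proof. by move=> fS; apply: smooth_family_sum => a _; exact: smooth_family_scale. Qed.

Lemma smooth_on_tf_sym_formula k (f : 'rV[R]_n -> tens R n k) :
  (forall a, smooth_on U (fun x => f x a)) ->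
  forall a, smooth_on U (fun x => tf_sym_formula (g x) (f x) a).
Proof.
move=> fS a; have PS := smooth_family_harmonic_part k (smooth_family_tensor_poly fS).
have := smooth_onM U_open (smooth_on_cst U_open ((k`!%:R)^-1))
  (smooth_onM U_open (smooth_on_cst U_open (mnm_fact (exponent predT a))%:R)
    (smooth_on_mcoeff (exponent predT a) PS)).
by apply: smooth_on_eq => // x _; rewrite ffunE.
Qed.
End Metric.

Lemma is_derive_big_sum (I : Type) (r : seq I) (A : pred I)
    (f : I -> 'rV[R]_n -> R) (df : I -> R) (x v : 'rV[R]_n) :
  (forall i, A i -> is_derive x v (f i) (df i)) ->
  is_derive x v (fun y => \sum_(i <- r | A i) f i y) (\sum_(i <- r | A i) df i).
Proof.
move=> fd; elim: r => [|i r IH].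
  rewrite big_nil (_ : (fun _ => _) = fun=> 0); last by apply/funext => y; rewrite big_nil.
  exact: is_derive_cst.
rewrite big_cons (_ : (fun _ => _) = fun y =>
    if A i then f i y + \sum_(j <- r | A j) f j y else \sum_(j <- r | A j) f j y).
  by case Ai : (A i) => //; exact: is_deriveD (fd i Ai) IH.
by apply/funext => y; rewrite big_cons.
Qed.

Lemma is_derive_mul (f h : 'rV[R]_n -> R) (df dh : R) (x v : 'rV[R]_n) :
  is_derive x v f df -> is_derive x v h dh ->
  is_derive x v (fun y => f y * h y) (df * h x + f x * dh).
Proof.
move=> fd hd; apply: is_derive_eq (is_deriveM fd hd) _.
by rewrite /GRing.scale /= addrC [h x * _]mulrC.
Qed.

(** The polynomials P' i are the partial derivatives of the family P at x with the
    fibre coordinates held fixed.  Being a relation, it can be propagated through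
    sums and products without any bound on degrees. *)
Definition coef_derive (P : 'rV[R]_n -> mpoly n R) x (P' : 'I_n -> mpoly n R) :=
  forall i mu, is_derive x (e_ i) (fun y => mcoeff mu (P y)) (mcoeff mu (P' i)).

Lemma coef_deriveM P Q x P' Q' : coef_derive P x P' -> coef_derive Q x Q' ->
  coef_derive (fun y => P y * Q y) x (fun i => P' i * Q x + P x * Q' i).
Proof.
move=> dP dQ i mu; rewrite mcoeffD !mcoeffM -big_split /=.
rewrite (_ : (fun _ => _) = fun y =>
    \sum_(k : (bmultinom n (mdeg mu).+1 * bmultinom n (mdeg mu).+1)%type |
       mu == mnm_add k.1 k.2)
      mcoeff k.1 (P y) * mcoeff k.2 (Q y)).
  by apply: is_derive_big_sum => k _; apply: is_derive_mul.
by apply/funext => y; rewrite mcoeffM.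
Qed.

Lemma coef_deriveD P Q x P' Q' : coef_derive P x P' -> coef_derive Q x Q' ->
  coef_derive (fun y => P y + Q y) x (fun i => P' i + Q' i).
Proof.
move=> dP dQ i mu; rewrite mcoeffD.
rewrite (_ : (fun _ => _) = fun y => mcoeff mu (P y) + mcoeff mu (Q y)).
  by apply: is_deriveD.
by apply/funext => y; rewrite mcoeffD.
Qed.

Lemma coef_derive_scale (f : 'rV[R]_n -> R) x (f' : 'I_n -> R) (p : mpoly n R) :
  (forall i, is_derive x (e_ i) f (f' i)) ->
  coef_derive (fun y => f y *: p) x (fun i => f' i *: p).
Proof.
move=> df i mu; rewrite mcoeffZ.
rewrite (_ : (fun _ => _) = fun y => f y * mcoeff mu p).
  by apply: is_derive_eq (is_derive_mul (df i) (is_derive_cst (mcoeff mu p) x (e_ i))) _;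
     rewrite mulr0 addr0.
by apply/funext => y; rewrite mcoeffZ.
Qed.

Lemma coef_derive_eq P Q x P' : U x -> (forall y, U y -> P y = Q y) ->
  coef_derive P x P' -> coef_derive Q x P'.
Proof.
move=> Ux PQ dP i mu; apply: near_eq_is_derive (dP i mu).
by apply: (near_eq_on U_open Ux) => y Uy; rewrite PQ.
Qed.

Lemma smooth_family_coef_derive P x : U x -> smooth_family P ->
  exists P', coef_derive P x P'.
Proof.
move=> Ux; elim=> {P} [h p hS|P Q _ [P' dP] _ [Q' dQ]|P Q PQ _ [P' dP]].
- exists (fun i => partial i h x *: p); apply: coef_derive_scale => i.
  exact: (smooth_on_is_derive i Ux hS).
- by exists (fun i => P' i + Q' i); exact: coef_deriveD.
- by exists P'; exact: coef_derive_eq dP.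
Qed.

Lemma coef_derive_unique P x P' P'' : coef_derive P x P' -> coef_derive P x P'' ->
  P' =1 P''.
Proof.
move=> d1 d2 i; apply/mpolyP => mu.
by have [_ <-] := d1 i mu; have [_ <-] := d2 i mu.
Qed.

Section Spray.
Variable Gamma : 'I_n -> 'I_n -> 'I_n -> R.

(** The value of the derivation along the spray, given a polynomial F and the
    partial derivatives F' of its coefficients. *)
Definition spray (F : mpoly n R) (F' : 'I_n -> mpoly n R) : mpoly n R :=
  \sum_c var c * (F' c - \sum_d \sum_e Gamma d c e *: (var e * mderiv d F)).

Definition geodesic_derive P x (G : mpoly n R) :=
  exists2 P', coef_derive P x P' & G = spray (P x) P'.

Lemma geodesic_derive_unique P x G H :
  geodesic_derive P x G -> geodesic_derive P x H -> G = H.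
Proof.
move=> [P' d1 ->] [P'' d2 ->]; apply: eq_bigr => c _.
by rewrite (coef_derive_unique d1 d2).
Qed.

Lemma geodesic_derive_eq P Q x G : U x -> (forall y, U y -> P y = Q y) ->
  geodesic_derive P x G -> geodesic_derive Q x G.
Proof.
by move=> Ux PQ [P' dP ->]; exists P'; [exact: coef_derive_eq dP|rewrite PQ].
Qed.

Lemma geodesic_derive_exists P x : U x -> smooth_family P ->
  exists G, geodesic_derive P x G.
Proof.
by move=> Ux /(smooth_family_coef_derive Ux)[P' dP]; exists (spray (P x) P'); exists P'.
Qed.

Lemma geodesic_deriveD P Q x G H :
  geodesic_derive P x G -> geodesic_derive Q x H ->
  geodesic_derive (fun y => P y + Q y) x (G + H).
Proof.
move=> [P' dP ->] [Q' dQ ->]; exists (fun i => P' i + Q' i); first exact: coef_deriveD.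
rewrite /spray -big_split; apply: eq_bigr => c _ /=; rewrite -mulrDr; congr (_ * _).
rewrite addrACA -opprD -big_split; congr (_ - _); apply: eq_bigr => d _ /=.
rewrite -big_split; apply: eq_bigr => e _ /=.
by rewrite mderivD mulrDr scalerDr.
Qed.

Lemma geodesic_deriveM P Q x G H :
  geodesic_derive P x G -> geodesic_derive Q x H ->
  geodesic_derive (fun y => P y * Q y) x (G * Q x + P x * H).
Proof.
move=> [P' dP ->] [Q' dQ ->].
exists (fun i => P' i * Q x + P x * Q' i); first exact: coef_deriveM.
rewrite /spray mulr_suml mulr_sumr -big_split; apply: eq_bigr => c _ /=.
pose S F : mpoly n R := \sum_d \sum_e Gamma d c e *: (var e * mderiv d F).
rewrite -!/(S _) (_ : S (P x * Q x) = S (P x) * Q x + P x * S (Q x)).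
  by ring.
rewrite /S mulr_suml mulr_sumr -big_split; apply: eq_bigr => d _ /=.
rewrite mulr_suml mulr_sumr -big_split; apply: eq_bigr => e _ /=.
rewrite mderivM mulrDr scalerDr -!scalerAl -!scalerAr; congr (_ *: _ + _ *: _); ring.
Qed.

Lemma geodesic_derive_scalar (f : 'rV[R]_n -> R) x (f' : 'I_n -> R) :
  (forall i, is_derive x (e_ i) f (f' i)) ->
  geodesic_derive (fun y => f y *: 1) x (\sum_c f' c *: var c).
Proof.
move=> df; exists (fun i => f' i *: 1); first exact: coef_derive_scale.
apply: eq_bigr => c _; rewrite big1 ?subr0 => [|d _].
  by rewrite -scalerAr mulr1.
by rewrite big1 // => e _; rewrite mderivZ -mpolyC1 mderivC scaler0 mulr0 scaler0.
Qed.

Lemma geodesic_derive_var a x :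
  geodesic_derive (fun=> var a) x (- \sum_c \sum_e Gamma a c e *: (var c * var e)).
Proof.
exists (fun=> 0).
  move=> i mu; rewrite mcoeff0; exact: is_derive_cst.
rewrite /spray -sumrN; apply: eq_bigr => c _; rewrite sub0r mulrN; congr (- _).
rewrite [X in var c * X](bigD1 a) //= [X in _ + X]big1 => [|d da].
  rewrite addr0 mulr_sumr; apply: eq_bigr => e _.
  by rewrite mderiv_var eqxx scale1r mulr1 scalerAr.
by rewrite big1 // => e _; rewrite mderiv_var eq_sym (negbTE da) scale0r mulr0 scaler0.
Qed.

Lemma geodesic_derive_cst p x : (forall d, mderiv d p = 0) ->
  geodesic_derive (fun=> p) x 0.
Proof.
move=> p0; exists (fun=> 0); first by move=> i mu; rewrite mcoeff0; exact: is_derive_cst.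
rewrite /spray big1 // => c _; rewrite big1 ?subr0 ?mulr0 // => d _.
by rewrite big1 // => e _; rewrite p0 mulr0 scaler0.
Qed.

Lemma geodesic_derive_sum (I : Type) (r : seq I) (A : pred I)
    (P : I -> 'rV[R]_n -> mpoly n R) x (G : I -> mpoly n R) :
  (forall i, A i -> geodesic_derive (P i) x (G i)) ->
  geodesic_derive (fun y => \sum_(i <- r | A i) P i y) x (\sum_(i <- r | A i) G i).
Proof.
move=> PG; elim: r => [|i r IH].
  rewrite big_nil (_ : (fun _ => _) = fun=> 0); last by apply/funext => y; rewrite big_nil.
  by apply: geodesic_derive_cst => d; rewrite mderiv0.
rewrite big_cons (_ : (fun _ => _) = fun y =>
    if A i then P i y + \sum_(j <- r | A j) P j y else \sum_(j <- r | A j) P j y).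
  by case Ai : (A i) => //; exact: geodesic_deriveD (PG i Ai) IH.
by apply/funext => y; rewrite big_cons.
Qed.

Lemma geodesic_derive_prod (I : eqType) (r : seq I) (A : pred I)
    (P : I -> 'rV[R]_n -> mpoly n R) x (G : I -> mpoly n R) : uniq r ->
  (forall i, A i -> geodesic_derive (P i) x (G i)) ->
  geodesic_derive (fun y => \prod_(i <- r | A i) P i y) x
    (\sum_(i <- r | A i) G i * \prod_(j <- r | A j && (j != i)) P j x).
Proof.
move=> + PG; elim: r => [_|i r IH /= /andP[ir ur]].
  rewrite big_nil (_ : (fun _ => _) = fun=> 1); last by apply/funext => y; rewrite big_nil.
  by apply: geodesic_derive_cst => d; rewrite -mpolyC1 mderivC.
have rE B : \prod_(j <- r | B j && (j != i)) P j x = \prod_(j <- r | B j) P j x.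
  rewrite big_seq_cond [RHS]big_seq_cond; apply: eq_bigl => j.
  by case jr : (j \in r) => //=; rewrite (memPn ir) ?andbT.
rewrite big_cons (_ : (fun _ => _) = fun y =>
    if A i then P i y * \prod_(j <- r | A j) P j y else \prod_(j <- r | A j) P j y);
  last by apply/funext => y; rewrite big_cons.
case Ai : (A i).
  apply: eq_ind (geodesic_deriveM (PG i Ai) (IH ur)) _ _.
  rewrite big_cons eqxx andbF rE; congr (_ + _); rewrite mulr_sumr.
  rewrite [LHS]big_seq_cond [RHS]big_seq_cond; apply: eq_bigr => j /andP[jr _].
  have ij : i != j by apply: contraNneq ir => ->.
  by rewrite big_cons Ai ij /= mulrCA.
apply: eq_ind (IH ur) _ _; apply: eq_bigr => j _.
by rewrite big_cons Ai.
Qed.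
End Spray.
End SmoothFamily.

(** * The Levi-Civita spray *)

Section LeviCivita.
Local Open Scope classical_set_scope.
Local Open Scope ring_scope.
Context {R : realType} {n : nat} {M : smooth_manifold R n}.
Lemma chart_image_open (i : chart M) : open (chart_image i).
Proof. exact: image_open. Qed.

Variables (g : metric M) (i : chart M) (x : 'rV[R]_n).
Hypothesis Ux : chart_image i x.

Local Notation var c := (mpolyX R (mnm1 c) : mpoly n R).
Local Notation e_ c := (delta_mx 0 c : 'rV[R]_n).
Local Notation U := (chart_image i).
Local Notation Gamma := (christoffel g i x).
Local Notation gx := (gmx g i x).

Let gS := metric_sym g Ux.
Let gU := metric_nondegenerate g Ux.

Let dg c a b := partial c (fun y => gmx g i y a b) x.

Lemma is_derive_metric c a b : is_derive x (e_ c) (fun y => gmx g i y a b) (dg c a b).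
Proof. exact: (smooth_on_is_derive c Ux (metric_smooth g i a b)). Qed.

Lemma dg_sym c a b : dg c a b = dg c b a.
Proof.
apply: near_eq_derive; apply: (near_eq_on (@chart_image_open i) Ux) => y Uy.
by rewrite (sym_mxE _ _ (metric_sym g Uy)).
Qed.

(** The Koszul formula. *)
Lemma christoffel_lower d a b :
  \sum_(f < n) gx d f * Gamma f a b = 2^-1 * (dg a b d + dg b a d - dg d a b).
Proof.
rewrite /christoffel -!/(dg _ _ _).
under eq_bigr do rewrite mulrCA mulr_sumr.
rewrite -mulr_sumr exchange_big; congr (_ * _) => /=.
under eq_bigr => e _.
  under eq_bigr do rewrite mulrA.
  rewrite -mulr_suml (_ : \sum_f _ = (d == e)%:R).
    over.
  by have := congr1 (fun A : 'M[R]_n => A d e) (mulmxV gU); rewrite !mxE.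
rewrite (bigD1 d) //= eqxx mul1r big1 ?addr0 // => e; rewrite eq_sym => /negbTE ->.
by rewrite mul0r.
Qed.

Lemma metric_compatible c a b :
  dg c a b = \sum_(f < n) gx b f * Gamma f c a + \sum_(f < n) gx a f * Gamma f c b.
Proof.
by rewrite !christoffel_lower (dg_sym c b a); field.
Qed.

(** The component of the connection form in the direction X. *)
Definition connection_form (a b : 'I_n) : mpoly n R := \sum_c Gamma a c b *: var c.

Local Notation gam := connection_form.

Lemma geodesic_derive_coord a :
  geodesic_derive Gamma (fun=> var a) x (- \sum_e gam a e * var e).
Proof.
apply: eq_ind (geodesic_derive_var Gamma a x) _ _; congr (- _).
rewrite exchange_big; apply: eq_bigr => e _ /=; rewrite mulr_suml.
by apply: eq_bigr => c _; rewrite scalerAl.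
Qed.

(** The speed of a geodesic is constant. *)
Lemma geodesic_derive_quadric :
  geodesic_derive Gamma (fun y => quadric (gmx g i y)) x 0.
Proof.
exists (fun c => \sum_a \sum_b dg c a b *: (var a * var b)).
  move=> c mu; rewrite !raddf_sum.
  rewrite (_ : (fun _ => _) = fun y =>
      \sum_a \sum_b gmx g i y a b * mcoeff mu (var a * var b)); last first.
    apply/funext => y; rewrite raddf_sum; apply: eq_bigr => a _.
    by rewrite raddf_sum; apply: eq_bigr => b _; rewrite /= mcoeffZ.
  apply: is_derive_big_sum => a _; rewrite raddf_sum.
  apply: is_derive_big_sum => b _; rewrite /= mcoeffZ.
  apply: is_derive_eq (is_derive_mul (is_derive_metric c a b)
    (is_derive_cst (mcoeff mu (var a * var b)) x (e_ c))) _.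
  by rewrite mulr0 addr0.
rewrite /spray big1 // => c _; rewrite (_ : _ - _ = 0) ?mulr0 //; apply/eqP.
rewrite subr_eq0; apply/eqP/esym.
(* The last two terms are skew in (e, f). *)
transitivity (\sum_e \sum_f (dg c e f + dg e c f - dg f c e) *: (var e * var f)).
  rewrite exchange_big; apply: eq_bigr => e _ /=.
  under eq_bigr do rewrite mderiv_quadric // -scalerAr scalerA mulr_sumr scaler_sumr.
  rewrite exchange_big; apply: eq_bigr => f _ /=.
  have -> : dg c e f + dg e c f - dg f c e = 2 * \sum_d gx f d * Gamma d c e.
    by rewrite christoffel_lower; field.
  rewrite mulr_sumr scaler_suml; apply: eq_bigr => d _.
  rewrite -scalerAr scalerA (sym_mxE _ _ gS); congr (_ *: _); ring.
under eq_bigr do under eq_bigr do rewrite -addrA scalerDl.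
under eq_bigr do rewrite big_split.
rewrite big_split /= -[RHS]addr0; congr (_ + _).
under eq_bigr do under eq_bigr do rewrite scalerBl.
under eq_bigr do rewrite sumrB.
rewrite sumrB [X in _ - X]exchange_big /=; apply/eqP; rewrite subr_eq0; apply/eqP.
by apply: eq_bigr => e _; apply: eq_bigr => f _; rewrite [var f * _]mulrC.
Qed.

(** Obtained by differentiating h g = 1, which gives dh = - h (dg) h, and inserting
    metric compatibility. *)
Lemma is_derive_invmx c a b :
  is_derive x (e_ c) (fun y => invmx (gmx g i y) a b)
    (- (\sum_e Gamma a c e * invmx gx e b + \sum_e Gamma b c e * invmx gx a e)).
Proof.
pose dh a b := partial c (fun y => invmx (gmx g i y) a b) x.
have dhE a' b' : is_derive x (e_ c) (fun y => invmx (gmx g i y) a' b') (dh a' b').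
  apply: (smooth_on_is_derive c Ux).
  apply: (smooth_on_invmx (@chart_image_open i)); first by move=> y; exact: metric_nondegenerate.
  by move=> u v; exact: metric_smooth.
pose H := invmx gx; pose D := \matrix_(a, b) dg c a b.
pose G := \matrix_(a, b) Gamma a c b; pose dH := \matrix_(a, b) dh a b.
(* With G the connection matrix in the direction c, metric compatibility. *)
have DE : D = (gx *m G)^T + gx *m G.
  apply/matrixP => u v; rewrite !mxE metric_compatible.
  by congr (_ + _); apply: eq_bigr => f _; rewrite mxE.
have dHE : dH *m gx + H *m D = 0.
  apply/matrixP => u v; rewrite !mxE -big_split /=.
  have d1 := @is_derive_big_sum _ _ _ (index_enum 'I_n) xpredT _ _ _ _
    (fun e _ => is_derive_mul (dhE u e) (is_derive_metric c e v)).
  have d2 : is_derive x (e_ c) (fun y => \sum_e invmx (gmx g i y) u e * gmx g i y e v) 0.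
    have d0 : is_derive x (e_ c) (fun=> (u == v)%:R : R) 0 by exact: is_derive_cst.
    apply: near_eq_is_derive d0.
    apply: (near_eq_on (@chart_image_open i) Ux) => y Uy.
    by rewrite sum_invmx // metric_nondegenerate.
  have [_ e1] := d1; have [_ e2] := d2; rewrite -[RHS]e2 e1.
  by apply: eq_bigr => e _; rewrite !mxE.
have {}dHE : dH = - (G *m H + H *m G^T).
  move/eqP: dHE; rewrite addr_eq0 => /eqP dHE.
  apply: (can_inj (mulmxK gU)); rewrite dHE DE mulNmx; congr (- _).
  rewrite mulmxDl -[G *m H *m gx]mulmxA /H mulVmx // mulmx1 mulmxDr mulKmx //.
  by rewrite trmx_mul gS mulmxA addrC.
apply: is_derive_eq (dhE a b) _.
have := congr1 (fun A : 'M[R]_n => A a b) dHE; rewrite !mxE => ->.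
congr (- (_ + _)); apply: eq_bigr => e _; rewrite !mxE // mulrC //.
Qed.

Lemma geodesic_derive_invmx a b :
  geodesic_derive Gamma (fun y => invmx (gmx g i y) a b *: 1) x
    (- (\sum_e invmx gx e b *: gam a e + \sum_e invmx gx a e *: gam b e)).
Proof.
apply: eq_ind (geodesic_derive_scalar Gamma (fun c => is_derive_invmx c a b)) _ _.
under eq_bigr do rewrite scaleNr scalerDl.
rewrite sumrN big_split /=; congr (- (_ + _)).
  under eq_bigr do rewrite scaler_suml; rewrite exchange_big; apply: eq_bigr => e _ /=.
  by rewrite /gam scaler_sumr; apply: eq_bigr => c _; rewrite scalerA mulrC.
under eq_bigr do rewrite scaler_suml; rewrite exchange_big; apply: eq_bigr => e _ /=.
by rewrite /gam scaler_sumr; apply: eq_bigr => c _; rewrite scalerA mulrC.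
Qed.

(** Contracting nabla T with X in all slots: the sum over the index of the
    Christoffel symbol and the entry of T are exchanged. *)
Lemma geodesic_derive_tensor_poly k (T : wfield M k) :
  (forall a, smooth_on U (fun y => T g i y a)) ->
  geodesic_derive Gamma (fun y => tensor_poly (T g i y)) x (tensor_poly (nabla g T i x)).
Proof.
move=> TS; pose dT c a := partial c (fun y => T g i y a) x.
pose m0 s (a : multiindex n k) := @monom R n k (fun t => predT t && (t != s)) a.
have dmon (a : multiindex n k) : geodesic_derive Gamma (fun=> monom predT a) x
    (\sum_s (- \sum_e gam (a s) e * var e) * m0 s a).
  apply: (geodesic_derive_prod (index_enum_uniq _)) => s _.
  exact: geodesic_derive_coord.
have dscal a : geodesic_derive Gamma (fun y => T g i y a *: 1) x (\sum_c dT c a *: var c).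
  by apply: geodesic_derive_scalar => c; exact: (smooth_on_is_derive c Ux (TS a)).
have := @geodesic_derive_sum _ _ Gamma _ (index_enum _) xpredT _ _ _
  (fun a _ => geodesic_deriveM (dscal a) (dmon a)).
rewrite (_ : (fun y => _) = (fun y => tensor_poly (T g i y))); last first.
  by apply/funext => y; apply: eq_bigr => a _; rewrite -scalerAl mul1r.
move=> dP; apply: eq_ind dP _ _; rewrite big_split /= [RHS]/tensor_poly.
rewrite sum_cons_index exchange_big /=.
under [RHS]eq_bigr => a _.
  under eq_bigr => c _.
    rewrite ffunE tail_cons cons_index0 monom_cons scalerBl.
    over.
  rewrite sumrB; over.
rewrite sumrB; congr (_ + _).
  apply: eq_bigr => a _; rewrite mulr_suml; apply: eq_bigr => c _.
  by rewrite scalerAl.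
under eq_bigr do rewrite -scalerAl mul1r scaler_sumr.
rewrite exchange_big /=.
transitivity (- \sum_s \sum_(a : multiindex n k) \sum_d
     T g i x (upd a s d) *: (gam d (a s) * var (a s) * m0 s a)).
  rewrite -sumrN; apply: eq_bigr => s _.
  rewrite (sum_swap s) -sumrN; apply: eq_bigr => a _ /=.
  rewrite mulNr scalerN mulr_suml scaler_sumr; congr (- _); apply: eq_bigr => d _.
  by rewrite upd_upd upd_id upd_same /m0 monom_upd ?eqxx.
congr (- _); rewrite exchange_big; apply: eq_bigr => a _ /=.
under [RHS]eq_bigr do rewrite scaler_suml.
rewrite [RHS]exchange_big; apply: eq_bigr => s _ /=.
under [RHS]eq_bigr do rewrite scaler_suml.
rewrite [RHS]exchange_big; apply: eq_bigr => d _ /=.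
rewrite /gam !mulr_suml scaler_sumr; apply: eq_bigr => c _.
rewrite cons_indexS (monomD1 a (s := s)) //.
rewrite -2!scalerAl scalerA mulrA; congr (_ *: _); exact: mulrC.
Qed.
End LeviCivita.

(** * Contractions over paired slots *)

Lemma alternating_tperm (R : realType) n k (f : tens R n k) (s t : 'I_k) a :
  alternating_tensor f -> s != t -> f (perm_index a (tperm s t)) = - f a.
Proof. by move=> fA st; rewrite fA odd_tperm st expr1 mulN1r. Qed.

Lemma eq_opp0 (R : realType) (V : lmodType R) (v : V) : v = - v -> v = 0.
Proof.
move/eqP; rewrite -addr_eq0 -mulr2n -scaler_nat scaler_eq0 pnatr_eq0 /=.
by move/eqP.
Qed.

Section Slots.
Variables (m : nat) (r : 'I_m -> nat).
Local Notation slot := (@slot m r).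
Variable free : forall l, 'I_(r l).

Lemma suppressedE (y : slot) : suppressed free y = (tagged y != free (tag y)).
Proof.
apply/forallP/idP => [/(_ (tag y))|yf l].
  by apply: contraNneq => <-; case: y.
apply: contraNneq yf => ->; by rewrite /mkslot /=.
Qed.

Lemma suppressed_free l : suppressed free (mkslot (free l)) = false.
Proof. by rewrite suppressedE eqxx. Qed.

Lemma not_suppressed (y : slot) : ~~ suppressed free y -> y = mkslot (free (tag y)).
Proof. by rewrite suppressedE negbK => /eqP <-; case: y. Qed.

Lemma mkslot_inj l : injective (@mkslot m r l).
Proof. by move=> s t /eqP; rewrite eq_Tagged => /eqP. Qed.

Lemma free_inj : injective (fun l => mkslot (free l)).
Proof. by move=> l l' /(congr1 tag). Qed.

Variable pair : slot -> slot.
Hypothesis pairP : complete_pairing free pair.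

(** One slot out of each contracted pair, the one by which [contraction] indexes
    this pair. *)
Definition leading (y : slot) : bool :=
  suppressed free y && (enum_rank y < enum_rank (pair y))%N.

Lemma leading_suppressed y : leading y -> suppressed free y.
Proof. by case/andP. Qed.

Lemma leading_pair y : suppressed free y -> leading (pair y) = ~~ leading y.
Proof.
move=> ys; have [ps pn pp] := pairP ys.
rewrite /leading ys ps pp /= -leqNgt ltn_neqAle val_eqE.
by rewrite (inj_eq enum_rank_inj) pn.
Qed.

Section Big.
Variables (V : Type) (idx : V) (op : Monoid.com_law idx).
Implicit Type F : slot -> V.

Lemma big_slot_tag F :
  \big[op/idx]_y F y = \big[op/idx]_l \big[op/idx]_(s < r l) F (mkslot s).
Proof. by rewrite sig_big_dep; apply: eq_bigr => -[]. Qed.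

Lemma big_suppressed F :
  \big[op/idx]_(y | suppressed free y) F y
  = \big[op/idx]_(y | leading y) op (F y) (F (pair y)).
Proof.
rewrite (bigID leading) big_split /=; congr (op _ _).
  by apply: eq_bigl => y; rewrite andb_idl //; exact: leading_suppressed.
rewrite (reindex_onto pair pair) /= => [|y /andP[ys yl]]; last first.
  by have [] := pairP ys.
apply: eq_bigl => y; case ys : (suppressed free y).
  have [ps _ pp] := pairP ys.
  by rewrite ps pp eqxx leading_pair // negbK andbT.
rewrite {2}/leading ys /=; apply/negbTE/negP => /andP[/andP[ps _] /eqP pp].
by have [] := pairP ps; rewrite pp ys.
Qed.

Lemma big_slot F : \big[op/idx]_y F y
  = op (\big[op/idx]_l F (mkslot (free l)))
       (\big[op/idx]_(y | leading y) op (F y) (F (pair y))).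
Proof.
rewrite (bigID (suppressed free)) /= Monoid.mulmC -big_suppressed; congr (op _ _).
rewrite (reindex_onto (fun l => mkslot (free l)) tag) /= => [|y ys]; last first.
  exact/esym/not_suppressed.
by apply: eq_bigl => l; rewrite suppressed_free eqxx.
Qed.
End Big.

Lemma leading_neq_free y l : leading y -> y != mkslot (free l).
Proof.
by move=> /leading_suppressed; apply: contraTneq => ->; rewrite suppressed_free.
Qed.

Lemma leading_pair_neq_free y l : leading y -> pair y != mkslot (free l).
Proof.
move=> /leading_suppressed/pairP[+ _ _].
by apply: contraTneq => ->; rewrite suppressed_free.
Qed.

Lemma leading_pair_neq y z : leading y -> leading z -> pair y != z.
Proof.
move=> yl zl; apply: contraTneq zl => <-.
by rewrite leading_pair ?yl // leading_suppressed.
Qed.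

Lemma pair_inj y z : suppressed free y -> suppressed free z -> pair y = pair z -> y = z.
Proof. by move=> /pairP[_ _ yp] /pairP[_ _ zp] e; rewrite -yp e zp. Qed.

Variables (R : realType) (n : nat).
Implicit Types (S : forall l, tens R n (r l)) (g H : 'M[R]_n) (A : {ffun slot -> 'I_n}).

Local Notation var c := (mpolyX R (mnm1 c) : mpoly n R).

Definition slice A l : multiindex n (r l) := [ffun s => A (mkslot s)].

Definition contract S H : tens R n m :=
  [ffun b : {ffun 'I_m -> 'I_n} =>
    \sum_(A : {ffun slot -> 'I_n} | [forall l, A (mkslot (free l)) == b l])
      (\prod_(l < m) S l (slice A l))
      * \prod_(y | leading y) H (A y) (A (pair y))].

(** The part of the contraction that does not involve the forms, for one
    assignment A of all the indices, with X inserted for the free ones. *)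
Definition weight H A : mpoly n R :=
  (\prod_(y | leading y) H (A y) (A (pair y))) *: \prod_l var (A (mkslot (free l))).

Lemma tensor_poly_contract S H :
  tensor_poly (contract S H)
  = \sum_(A : {ffun slot -> 'I_n}) (\prod_l S l (slice A l)) *: weight H A.
Proof.
pose fr A : {ffun 'I_m -> 'I_n} := [ffun l => A (mkslot (free l))].
rewrite [RHS](partition_big fr predT) //=; apply: eq_bigr => b _.
rewrite ffunE scaler_suml.
have frE A : [forall l, A (mkslot (free l)) == b l] = (fr A == b).
  apply/forallP/eqP => [e|<- l]; last by rewrite ffunE.
  by apply/ffunP => l; rewrite ffunE; exact/eqP.
apply: eq_big => A; first exact: frE.
rewrite frE => /eqP <-; rewrite /weight scalerA; congr (_ *: _).
by apply: eq_bigr => l _; rewrite ffunE.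
Qed.

(** An assignment of the contracted slots is a function from the leading slots to
    pairs of indices; i0 is its default value elsewhere. *)
Lemma sum_prod_pairs (i0 : 'I_n) (b : 'I_m -> 'I_n) (phi : slot -> 'I_n -> 'I_n -> R) :
  \sum_(A : {ffun slot -> 'I_n} | [forall l, A (mkslot (free l)) == b l])
    \prod_(y | leading y) phi y (A y) (A (pair y))
  = \prod_(y | leading y) \sum_c \sum_d phi y c d.
Proof.
under [RHS]eq_bigr do rewrite pair_big /=.
rewrite (big_distr_big_dep (i0, i0)) /=.
pose h A : {ffun slot -> 'I_n * 'I_n} :=
  [ffun y => if leading y then (A y, A (pair y)) else (i0, i0)].
pose h' (f : {ffun slot -> 'I_n * 'I_n}) : {ffun slot -> 'I_n} :=
  [ffun y => if leading y then (f y).1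
             else if suppressed free y then (f (pair y)).2 else b (tag y)].
rewrite (reindex_onto h h') /=.
  apply: eq_big => A.
    apply/forallP/andP => [Ab|[_ /eqP <-] l]; last first.
      by rewrite ffunE /leading suppressed_free.
    split.
      apply/pfamilyP; split=> //; apply/fintype.subsetP => y; rewrite !inE ffunE.
      by case: ifP => //; rewrite eqxx.
    apply/eqP/ffunP => y; rewrite !ffunE; case: ifP => [->//|ly].
    case: ifP => ys; last first.
      by rewrite -(eqP (Ab (tag y))) -not_suppressed // ys.
    by rewrite leading_pair // ly /=; have [_ _ ->] := pairP ys.
  by move=> _; apply: eq_bigr => y ly; rewrite ffunE ly.
move=> f /pfamilyP[/fintype.subsetP fs _]; apply/ffunP => y; rewrite !ffunE.
case: ifP => ly; last first.
  apply/esym/eqP; apply: contraFT ly => fy; exact: (fs y).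
have ys := leading_suppressed ly; have [ps _ pp] := pairP ys.
by rewrite leading_pair // ly ps pp /=; case: (f y).
Qed.

(** A product of sums over multi-indices whose valence depends on the form: an
    assignment of all the slots is a dependent family of multi-indices. *)
Lemma prod_sum_slice (G : forall l, {ffun multiindex n (r l) -> R}) :
  \prod_l \sum_b G l b = \sum_(A : {ffun slot -> 'I_n}) \prod_l G l (slice A l).
Proof.
pose T l : finType := multiindex n (r l).
transitivity (\sum_(t : fprod T) \prod_(l in 'I_m) G l (t l)).
  rewrite (eq_bigr _ (fun l _ => @big_tag R 0 +%R _ T (fun l b => G l b) l)).
  by rewrite bigA_distr_big_dep (@big_fprod R 0 1 *%R +%R _ T G).
pose h A : fprod T := fprod_of_fun (fun l => slice A l).
rewrite (reindex h); last first.
  exists (fun t : fprod T => [ffun y : slot => t (tag y) (tagged y)]) => [A _|t _].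
    by apply/ffunP => -[l s]; rewrite ffunE fprodE ffunE.
  apply/fprodP => l; rewrite fprodE; apply/ffunP => s.
  by rewrite !ffunE.
by apply: eq_bigr => A _; apply: eq_bigr => l _; rewrite fprodE.
Qed.

(** Each contracted pair receives two Jacobians, which transform the inverse
    metric H into H'; each free slot keeps one. *)
Lemma contract_pullback (i0 : 'I_n) (J H H' : 'M[R]_n) S :
  J *m H *m J^T = H' ->
  contract (fun l => pullback J (S l)) H = pullback J (contract S H').
Proof.
move=> HE; apply/ffunP => a; rewrite !ffunE.
pose PB B := \prod_l S l (slice B l).
pose PJ A (B : {ffun slot -> 'I_n}) := \prod_(y : slot) J (B y) (A y).
have pbE A : \prod_l pullback J (S l) (slice A l) = \sum_B PJ A B * PB B.
  transitivity (\prod_l \sum_(b : multiindex n (r l))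
     [ffun b : multiindex n (r l) => (\prod_s J (b s) (slice A l s)) * S l b] b).
    by apply: eq_bigr => l _; rewrite ffunE; apply: eq_bigr => b _; rewrite ffunE.
  rewrite (prod_sum_slice (fun l => [ffun b : multiindex n (r l) =>
    (\prod_s J (b s) (slice A l s)) * S l b])).
  apply: eq_bigr => B _; rewrite /PJ big_slot_tag -big_split /=.
  apply: eq_bigr => l _; rewrite ffunE; congr (_ * _).
  by apply: eq_bigr => s _; rewrite !ffunE.
under eq_bigr => A _ do rewrite pbE mulr_suml.
rewrite exchange_big /=.
pose fr (A : {ffun slot -> 'I_n}) : {ffun 'I_m -> 'I_n} := [ffun l => A (mkslot (free l))].
rewrite (partition_big fr predT) //=; apply: eq_bigr => b _.
rewrite ffunE mulr_sumr.
have frE A : [forall l, A (mkslot (free l)) == b l] = (fr A == b).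
  apply/forallP/eqP => [e|<- l]; last by rewrite ffunE.
  by apply/ffunP => l; rewrite ffunE; exact/eqP.
apply: eq_big => B; first by rewrite frE.
move=> /eqP frB.
have jE A : [forall l, A (mkslot (free l)) == a l] -> PJ A B =
    \prod_l J (b l) (a l) *
    \prod_(y | leading y) (J (B y) (A y) * J (B (pair y)) (A (pair y))).
  move=> /forallP Aa; rewrite /PJ big_slot /=; congr (_ * _).
  by apply: eq_bigr => l _; rewrite -frB ffunE (eqP (Aa l)).
transitivity (\prod_l J (b l) (a l) * PB B *
  \sum_(A : {ffun slot -> 'I_n} | [forall l, A (mkslot (free l)) == a l])
    \prod_(y | leading y) (J (B y) (A y) * J (B (pair y)) (A (pair y)) * H (A y) (A (pair y)))).
  rewrite mulr_sumr; apply: eq_bigr => A Aa; rewrite (jE A Aa) !big_split /=.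
  by ring.
rewrite (sum_prod_pairs i0 a (fun y c d => J (B y) c * J (B (pair y)) d * H c d)).
rewrite mulrA; congr (_ * _); apply: eq_bigr => y _.
rewrite -HE mxE exchange_big; apply: eq_bigr => d _ /=.
rewrite !mxE mulr_suml; apply: eq_bigr => c _; ring.
Qed.

Lemma contract_scale (u : 'I_m -> R) (v : R) S H :
  contract (fun l => scale_tens (u l) (S l)) (v *: H)
  = scale_tens ((\prod_l u l) * \prod_(y | leading y) v) (contract S H).
Proof.
apply/ffunP => b; rewrite !ffunE mulr_sumr; apply: eq_bigr => A _.
rewrite (eq_bigr (fun l => u l * S l (slice A l))) => [|l _]; last exact: scale_tensE.
rewrite [X in _ * X](eq_bigr (fun y => v * H (A y) (A (pair y)))) => [|y _]; last by rewrite mxE.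
by rewrite !big_split /=; ring.
Qed.

Definition swap_slots A (y z : slot) : {ffun slot -> 'I_n} := [ffun t => A (tperm y z t)].

Lemma swap_slotsK y z : involutive (fun A => swap_slots A y z).
Proof. by move=> A; apply/ffunP => t; rewrite !ffunE tpermK. Qed.

Lemma slice_swap A l (s t : 'I_(r l)) l' : l' != l ->
  slice (swap_slots A (mkslot s) (mkslot t)) l' = slice A l'.
Proof.
move=> ll'; apply/ffunP => u; rewrite !ffunE tpermD //;
  by apply: contraNneq ll' => /(congr1 tag) /= ->.
Qed.

Lemma slice_swap_same A l (s t : 'I_(r l)) :
  slice (swap_slots A (mkslot s) (mkslot t)) l = perm_index (slice A l) (tperm s t).
Proof.
apply/ffunP => u; rewrite !ffunE; congr (A _).
have [->|us] := eqVneq u s; first by rewrite !tpermL.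
have [->|ut] := eqVneq u t; first by rewrite !tpermR.
by rewrite !tpermD // ?(inj_eq (@mkslot_inj _)) eq_sym.
Qed.

Lemma prod_slice_swap S A l (s t : 'I_(r l)) : alternating_tensor (S l) -> s != t ->
  \prod_k S k (slice (swap_slots A (mkslot s) (mkslot t)) k)
  = - \prod_k S k (slice A k).
Proof.
move=> SA st; rewrite (bigD1 l) //= [in RHS](bigD1 l) //= slice_swap_same.
rewrite alternating_tperm // mulNr; congr (- (_ * _)).
by apply: eq_bigr => k kl; rewrite slice_swap.
Qed.

Lemma slot_tag_inj (y z : slot) : tag y = tag z ->
  exists l (s t : 'I_(r l)), y = mkslot s /\ z = mkslot t.
Proof. by case: y z => l s [l' t] /= e; subst l'; exists l, s, t. Qed.

(** Exchanging the two contracted slots changes the sign of the form and fixes the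
    inverse metric. *)
Lemma contract_internal S H y : H^T = H -> suppressed free y ->
  tag (pair y) = tag y -> (forall l, alternating_tensor (S l)) -> contract S H = 0.
Proof.
move=> HS ys ty SA; apply/ffunP => b; rewrite !ffunE.
have [ps pn pp] := pairP ys.
apply: (@eq_opp0 R R^o).
rewrite {1}(reindex_inj (inv_inj (swap_slotsK y (pair y)))) /= -sumrN.
apply: eq_big => A.
  apply: eq_forallb => l; rewrite ffunE tpermD //.
    by apply: contraTneq ys => ->; rewrite suppressed_free.
  by apply: contraTneq ps => ->; rewrite suppressed_free.
move=> _; have [l [s [t [ye pe]]]] := slot_tag_inj (esym ty).
have -> : \prod_k S k (slice (swap_slots A y (pair y)) k) = - \prod_k S k (slice A k).
  rewrite pe ye prod_slice_swap //.
  by apply: contraNneq pn => st; rewrite pe ye st.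
rewrite mulNr; congr (- (_ * _)); apply: eq_bigr => z lz; rewrite !ffunE.
have [->|zy] := eqVneq z y; first by rewrite tpermL tpermR (sym_mxE _ _ HS).
have [->|zp] := eqVneq z (pair y); first by rewrite pp tpermL tpermR (sym_mxE _ _ HS).
have zs := leading_suppressed lz.
rewrite !tpermD 1?eq_sym //; last by apply: contra zy => /eqP/pair_inj ->.
by apply: contra zp => /eqP <-; have [_ _ ->] := pairP zs.
Qed.

(** The factor of [weight] that does not depend on the free slot of the form l. *)
Definition weight_off_free H A l : mpoly n R :=
  (\prod_(y | leading y) H (A y) (A (pair y)))
  *: \prod_(k | k != l) var (A (mkslot (free k))).

Lemma weight_free H A l :
  weight H A = var (A (mkslot (free l))) * weight_off_free H A l.
Proof. by rewrite /weight (bigD1 l) //= scalerAr. Qed.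

Lemma weight_off_free_upd H A l d :
  weight_off_free H (upd A (mkslot (free l)) d) l = weight_off_free H A l.
Proof.
congr (_ *: _); apply: eq_bigr => k kl.
  rewrite (upd_other _ _ (leading_neq_free l kl)).
  by rewrite (upd_other _ _ (leading_pair_neq_free l kl)).
by rewrite upd_other // (inj_eq free_inj).
Qed.

(** The factor of [weight] left after the contraction of the slots y and [pair y]. *)
Definition weight_off_pair H A y : R :=
  \prod_(z | leading z && ((z != y) && (z != pair y))) H (A z) (A (pair z)).

Lemma weight_pair H A y : H^T = H -> suppressed free y ->
  weight H A = (H (A y) (A (pair y)) * weight_off_pair H A y)
               *: \prod_l var (A (mkslot (free l))).
Proof.
move=> HS ys; have [ps pn pp] := pairP ys; congr (_ *: _).
rewrite /weight_off_pair; case ly : (leading y).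
  rewrite (bigD1 y) //=; congr (_ * _); apply: eq_bigl => z.
  case lz : (leading z) => //=; rewrite [X in _ && X](_ : _ = true) ?andbT //.
  by rewrite eq_sym leading_pair_neq.
have lp : leading (pair y) by rewrite leading_pair // ly.
rewrite (bigD1 (pair y)) //= pp (sym_mxE _ _ HS); congr (_ * _); apply: eq_bigl => z.
case lz : (leading z) => //=; rewrite [X in _ = X && _](_ : _ = true) //.
by apply: contraFneq ly => <-.
Qed.

Lemma weight_off_pair_eq H A (B : {ffun slot -> 'I_n}) y : suppressed free y ->
  (forall z, suppressed free z -> z != y -> z != pair y -> A z = B z) ->
  weight_off_pair H A y = weight_off_pair H B y.
Proof.
move=> ys AB; have [ps _ pp] := pairP ys.
apply: eq_bigr => z /andP[/leading_suppressed zs /andP[zy zp]].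
have [pzs _ pzp] := pairP zs.
rewrite !AB //; first by apply: contra zp => /eqP <-; rewrite pzp.
by apply: contra zy => /eqP/pair_inj ->.
Qed.

Lemma prod_free_upd A y d : suppressed free y ->
  \prod_k var (upd A y d (mkslot (free k))) = \prod_k var (A (mkslot (free k))).
Proof.
move=> ys; apply: eq_bigr => k _; rewrite upd_other //.
by apply: contraTneq ys => <-; rewrite suppressed_free.
Qed.

Lemma slice_upd A l (s : 'I_(r l)) d : slice (upd A (mkslot s) d) l = upd (slice A l) s d.
Proof. by apply/ffunP => t; rewrite !ffunE (inj_eq (@mkslot_inj _)). Qed.

Lemma slice_upd_other A l (s : 'I_(r l)) d k : k != l ->
  slice (upd A (mkslot s) d) k = slice A k.
Proof.
move=> kl; apply/ffunP => t; rewrite !ffunE; case: eqP => // /(congr1 tag) /= e.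
by rewrite e eqxx in kl.
Qed.

(** X is contracted into two slots of the skew tensor om, the first one and the
    free one. *)
Lemma skew_term0 S H l (om : tens R n (r l).+1) : alternating_tensor om ->
  \sum_(A : {ffun slot -> 'I_n}) \sum_c
    (om (cons_index c (slice A l)) * \prod_(k | k != l) S k (slice A k))
     *: (var c * weight H A) = 0.
Proof.
move=> omA; apply: (@eq_opp0 R (mpoly n R)).
rewrite {1}(sum_swap (mkslot (free l))) -sumrN; apply: eq_bigr => A _.
rewrite -sumrN; apply: eq_bigr => c _.
rewrite !(weight_free _ _ l) weight_off_free_upd upd_same slice_upd.
have -> : \prod_(k | k != l) S k (slice (upd A (mkslot (free l)) c) k)
    = \prod_(k | k != l) S k (slice A k).
  by apply: eq_bigr => k kl; rewrite slice_upd_other.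
have -> : cons_index (A (mkslot (free l))) (upd (slice A l) (free l) c)
    = perm_index (cons_index c (slice A l)) (tperm ord0 (lift ord0 (free l))).
  apply/ffunP => t; rewrite ffunE [RHS]ffunE.
  case: (unliftP ord0 t) => [u|] ->; last by rewrite tpermL cons_indexS ffunE.
  rewrite ffunE; case: eqVneq => [->|uf]; first by rewrite tpermR cons_index0.
  by rewrite tpermD ?cons_indexS // (inj_eq lift_inj) eq_sym.
by rewrite alternating_tperm // mulNr scaleNr mulrCA.
Qed.

(** The metric joins the differentiation index to the free slot, both of which
    are contracted with X. *)
Lemma free_term_div S H (g : 'M[R]_n) l : (0 < n)%N ->
  (forall a d, S l (upd a (free l) d) = S l a) ->
  exists q, \sum_(A : {ffun slot -> 'I_n}) \sum_c
    (g c (A (mkslot (free l))) * \prod_k S k (slice A k))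
     *: (var c * weight H A) = quadric g * q.
Proof.
move=> n0 SI; pose P A := \prod_k S k (slice A k).
exists (n%:R^-1 *: \sum_(A : {ffun slot -> 'I_n}) P A *: weight_off_free H A l).
have nn0 : n%:R != 0 :> R by rewrite pnatr_eq0 -lt0n.
apply: (scalerI nn0); rewrite [in RHS]scalerAr scalerA mulfV // scale1r.
rewrite scaler_nat -(sum_upd (mkslot (free l))) mulr_sumr; apply: eq_bigr => A _.
rewrite /quadric mulr_suml exchange_big; apply: eq_bigr => c _ /=.
rewrite mulr_suml; apply: eq_bigr => d _.
rewrite (weight_free _ _ l) weight_off_free_upd upd_same.
have -> : \prod_k S k (slice (upd A (mkslot (free l)) d) k) = P A.
  apply: eq_bigr => k _; have [->|kl] := eqVneq k l; first by rewrite slice_upd SI.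
  by rewrite slice_upd_other.
by rewrite -[RHS]scalerAl -[in RHS]scalerAr [RHS]scalerA -[in RHS]mulrA.
Qed.

(** The metric g cancels the inverse metric of the pair, which leaves X in the slot
    [pair (mkslot s)] of another form, whose free slot also receives X. *)
Lemma suppressed_term0 S (g : 'M[R]_n) l (s : 'I_(r l)) : (0 < n)%N -> g^T = g -> g \in unitmx ->
  suppressed free (mkslot s) -> tag (pair (mkslot s)) != l ->
  (forall k, k != l -> alternating_tensor (S k)) ->
  (forall a d, S l (upd a s d) = S l a) ->
  \sum_(A : {ffun slot -> 'I_n}) \sum_c (g c (A (mkslot s)) * \prod_k S k (slice A k))
     *: (var c * weight (invmx g) A) = 0.
Proof.
move=> n0 gS gU; set y := mkslot s => ys; have [ps pn pp] := pairP ys => pl SA SI.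
pose P A := \prod_k S k (slice A k).
pose K A := weight_off_pair (invmx g) A y *: \prod_l var (A (mkslot (free l))).
have nn0 : n%:R != 0 :> R by rewrite pnatr_eq0 -lt0n.
apply: (scalerI nn0); rewrite scaler0 scaler_nat -(sum_upd y).
transitivity (\sum_(A : {ffun slot -> 'I_n}) P A *: (var (A (pair y)) * K A)).
  apply: eq_bigr => A _.
  transitivity (\sum_d \sum_c (g c d * invmx g d (A (pair y))) *: (P A *: (var c * K A))).
    apply: eq_bigr => d _; apply: eq_bigr => c _.
    have -> : \prod_k S k (slice (upd A y d) k) = P A.
      apply: eq_bigr => k _; have [->|kl] := eqVneq k l; first by rewrite slice_upd SI.
      by rewrite slice_upd_other.
    rewrite (weight_pair _ (invmx_sym gS) ys) upd_same upd_other //.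
    rewrite (@weight_off_pair_eq _ _ A) // => [|z _ zy _]; last by rewrite upd_other.
    rewrite prod_free_upd //.
    rewrite /K -!scalerAr !scalerA; congr (_ *: _); ring.
  rewrite exchange_big /=.
  under eq_bigr => c _.
    rewrite -scaler_suml (_ : \sum_d _ = (c == A (pair y))%:R); last first.
      by have := congr1 (fun B : 'M[R]_n => B c (A (pair y))) (mulmxV gU); rewrite !mxE.
    over.
  by rewrite sum_deltar.
apply: (@eq_opp0 R (mpoly n R)).
pose f := mkslot (free (tag (pair y))).
rewrite {1}(reindex_inj (inv_inj (swap_slotsK (pair y) f))) /= -sumrN.
apply: eq_bigr => A _.
have [t pe] : exists t : 'I_(r (tag (pair y))), pair y = mkslot t.
  by case: (pair y) => k t; exists t.
have -> : P (swap_slots A (pair y) f) = - P A.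
  rewrite {1}pe; apply: prod_slice_swap; first exact: SA.
  by move: ps; rewrite {1}pe suppressedE.
rewrite scaleNr; congr (- (_ *: _)); rewrite /K.
rewrite (@weight_off_pair_eq _ _ A) // => [|z zs zy zp]; last first.
  rewrite ffunE tpermD // 1?eq_sym //.
  by apply: contraTneq zs => ->; rewrite suppressed_free.
rewrite -!scalerAr; congr (_ *: _).
rewrite (bigD1 (tag (pair y))) //= [in RHS](bigD1 (tag (pair y))) //= -/f.
rewrite !ffunE tpermL tpermR mulrCA; congr (_ * (_ * _)).
apply: eq_bigr => k kt; rewrite ffunE tpermD //.
  by apply: contraTneq ps => ->; rewrite suppressed_free.
by rewrite (inj_eq free_inj) eq_sym.
Qed.
End Slots.

(** * The Leibniz rule for contractions *)

Section Leibniz.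
Local Open Scope classical_set_scope.
Local Open Scope ring_scope.
Context {R : realType} {n : nat} {M : smooth_manifold R n}.
Variables (g : metric M) (i : chart M) (x : 'rV[R]_n).
Hypothesis Ux : chart_image i x.
Variables (m : nat) (r : 'I_m -> nat).
Local Notation slot := (@slot m r).
Variables (free : forall l, 'I_(r l)) (pair : slot -> slot).
Hypothesis pairP : complete_pairing free pair.

Local Notation var c := (mpolyX R (mnm1 c) : mpoly n R).
Local Notation Gamma := (christoffel g i x).
Local Notation gam := (connection_form g i x).
Local Notation h y := (invmx (gmx g i y)).
Local Notation leading := (leading free pair).
Local Notation weight := (weight free pair).

Lemma prod_alg (I : Type) (s : seq I) (P : pred I) (f : I -> R) :
  \prod_(j <- s | P j) (f j *: (1 : mpoly n R)) = (\prod_(j <- s | P j) f j) *: 1.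
Proof.
elim/big_rec2: _ => [|j a b _ ->]; first by rewrite scale1r.
by rewrite -scalerAl mul1r scalerA.
Qed.

Lemma scale_regroup (a b : R) (p v : mpoly n R) :
  (a *: p) * (b *: 1) * v = p * ((a * b) *: v).
Proof. by rewrite -!mul_mpolyC mpolyCM; ring. Qed.

(** Each inverse metric and each coordinate X contributes one connection form for
    each of its indices. *)
Lemma geodesic_derive_weight (A : {ffun slot -> 'I_n}) :
  geodesic_derive Gamma (fun y => weight (h y) A) x
    (- \sum_z \sum_e gam (A z) e * weight (h x) (upd A z e)).
Proof.
have hS := invmx_sym (metric_sym g Ux).
pose G z := - (\sum_e h x e (A (pair z)) *: gam (A z) e
               + \sum_e h x (A z) e *: gam (A (pair z)) e).
have dh := geodesic_derive_prod (index_enum_uniq slot) (fun z (_ : leading z) =>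
  geodesic_derive_invmx g Ux (A z) (A (pair z))).
have dv := geodesic_derive_prod (A := xpredT) (index_enum_uniq 'I_m) (fun l _ =>
  geodesic_derive_coord g i x (A (mkslot (free l)))).
have := geodesic_deriveM dh dv.
rewrite (_ : (fun y => _ * _) = (fun y => weight (h y) A)); last first.
  by apply/funext => y; rewrite prod_alg -scalerAl mul1r.
move=> d; apply: eq_ind d _ _; rewrite -!/(G _).
rewrite (big_slot pairP) /= opprD [RHS]addrC; congr (_ + _).
  rewrite mulr_suml -sumrN; apply: eq_bigr => z lz.
  have zs := leading_suppressed lz; have [ps pn pp] := pairP zs.
  rewrite prod_alg (_ : \prod_(j | _) _ = weight_off_pair free pair (h x) A z); last first.
    apply: eq_bigl => y; case ly : (leading y) => //=.
    by rewrite [X in _ && X](_ : _ = true) ?andbT // eq_sym (leading_pair_neq pairP).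
  rewrite /G mulNr mulNr; congr (- _); rewrite !mulrDl; congr (_ + _).
    rewrite !mulr_suml; apply: eq_bigr => e _.
    rewrite (weight_pair pairP _ hS zs) upd_same upd_other //.
    rewrite (@weight_off_pair_eq _ _ _ _ pairP _ _ _ _ A) // => [|y _ yz _];
      last by rewrite upd_other.
    by rewrite prod_free_upd // scale_regroup.
  rewrite !mulr_suml; apply: eq_bigr => e _.
  rewrite (weight_pair pairP _ hS zs) upd_same upd_other 1?eq_sym //.
  rewrite (@weight_off_pair_eq _ _ _ _ pairP _ _ _ _ A) // => [|y _ _ yz];
    last by rewrite upd_other.
  by rewrite prod_free_upd // scale_regroup.
rewrite prod_alg -scalerAl mul1r scaler_sumr -sumrN; apply: eq_bigr => l _.
rewrite mulNr scalerN mulr_suml scaler_sumr; congr (- _); apply: eq_bigr => e _.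
rewrite (weight_free free pair _ _ l) upd_same (weight_off_free_upd pairP).
by rewrite /weight_off_free -!scalerAr mulrA.
Qed.

Variable sigma : forall l : 'I_m, wfield M (r l).
Hypothesis sigma_smooth : forall l a, smooth_on (chart_image i) (fun y => sigma l g i y a).

Local Notation S y := (fun l => sigma l g i y).

(** The connection forms produced by the covariant derivatives of the forms cancel
    those of [geodesic_derive_weight] after the summed indices are exchanged. *)
Lemma geodesic_derive_contract :
  geodesic_derive Gamma (fun y => tensor_poly (contract free pair (S y) (h y))) x
   (\sum_l \sum_(A : {ffun slot -> 'I_n}) \sum_c
      (nabla g (sigma l) i x (cons_index c (slice A l))
        * \prod_(k | k != l) sigma k g i x (slice A k)) *: (var c * weight (h x) A)).
Proof.
pose ds l c a := partial c (fun y => sigma l g i y a) x.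
pose Pr (A : {ffun slot -> 'I_n}) := \prod_l sigma l g i x (slice A l).
pose Pr' (A : {ffun slot -> 'I_n}) l := \prod_(k | k != l) sigma k g i x (slice A k).
have dP (A : {ffun slot -> 'I_n}) :
    geodesic_derive Gamma (fun y => (\prod_l sigma l g i y (slice A l)) *: 1) x
      (\sum_l Pr' A l *: \sum_c ds l c (slice A l) *: var c).
  have := geodesic_derive_prod (A := xpredT) (index_enum_uniq 'I_m) (fun l _ =>
    geodesic_derive_scalar Gamma (fun c =>
      smooth_on_is_derive c Ux (@sigma_smooth l (slice A l)))).
  rewrite (_ : (fun y => \prod_(_ <- _ | _) _)
     = (fun y => (\prod_l sigma l g i y (slice A l)) *: 1)); last first.
    by apply/funext => y; rewrite prod_alg.
  move=> d; apply: eq_ind d _ _; apply: eq_bigr => l _.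
  by rewrite prod_alg -scalerAr mulr1.
have := @geodesic_derive_sum _ _ Gamma _ (index_enum _) xpredT _ _ _
  (fun A _ => geodesic_deriveM (dP A) (geodesic_derive_weight A)).
rewrite (_ : (fun y => _) = (fun y => tensor_poly (contract free pair (S y) (h y)))); last first.
  apply/funext => y; rewrite tensor_poly_contract; apply: eq_bigr => A _.
  by rewrite -scalerAl mul1r.
move=> d; apply: eq_ind d _ _.
rewrite big_split /= [RHS]exchange_big /=.
(* Exchange the index in slot s with the summed index of the connection form. *)
have key : \sum_(A : {ffun slot -> 'I_n}) ((Pr A *: 1) *
     (- \sum_z \sum_e gam (A z) e * weight (h x) (upd A z e)))
   = - \sum_(A : {ffun slot -> 'I_n}) \sum_l \sum_(s < r l) \sum_d
      (Pr' A l * sigma l g i x (upd (slice A l) s d)) *: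
        (gam d (A (mkslot s)) * weight (h x) A).
  rewrite -sumrN.
  under eq_bigr do rewrite -scalerAl mul1r scalerN scaler_sumr.
  rewrite !sumrN; congr (- _).
  rewrite exchange_big big_slot_tag [RHS]exchange_big; apply: eq_bigr => l _ /=.
  rewrite [RHS]exchange_big; apply: eq_bigr => s _ /=.
  rewrite [RHS](sum_swap (mkslot s)); apply: eq_bigr => A _; rewrite scaler_sumr.
  apply: eq_bigr => d _.
  rewrite upd_same slice_upd upd_upd.
  have -> : upd (slice A l) s (A (mkslot s)) = slice A l.
    by apply/ffunP => t; rewrite !ffunE; case: eqP => // ->.
  have -> : Pr' (upd A (mkslot s) d) l = Pr' A l.
    by apply: eq_bigr => k kl; rewrite slice_upd_other.
  congr (_ *: _); by rewrite /Pr (bigD1 l) //= mulrC.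
rewrite key -sumrB; apply: eq_bigr => A _.
rewrite mulr_suml -sumrB; apply: eq_bigr => l _.
under [RHS]eq_bigr => c _.
  rewrite ffunE tail_cons cons_index0 mulrBl scalerBl.
  over.
rewrite sumrB; congr (_ - _).
  rewrite -scalerAl mulr_suml scaler_sumr; apply: eq_bigr => c _.
  by rewrite -scalerAl scalerA mulrC.
under [RHS]eq_bigr do rewrite !mulr_suml scaler_suml.
rewrite [RHS]exchange_big; apply: eq_bigr => s _ /=.
under [RHS]eq_bigr do rewrite mulr_suml scaler_suml.
rewrite [RHS]exchange_big; apply: eq_bigr => d _ /=.
rewrite /gam mulr_suml scaler_sumr; apply: eq_bigr => c _.
rewrite cons_indexS -scalerAl scalerA ffunE; congr (_ *: _).
by rewrite -/(Pr' A l) mulrC [Pr' A l * _]mulrC mulrA.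
Qed.
End Leibniz.

(** * Trace-free hook tensors *)

Section Hook.
Context {R : realType} {n : nat}.
Implicit Types (g : 'M[R]_n).

Lemma perm_indexM k (a : multiindex n k) (s t : 'S_k) :
  perm_index (perm_index a s) t = perm_index a (t * s)%g.
Proof. by apply/ffunP => u; rewrite !ffunE permM. Qed.

Lemma antisymmetrization_alternating k (f : tens R n k) :
  alternating_tensor (antisymmetrization f).
Proof.
move=> s a; rewrite !ffunE mulrCA; congr (_ * _).
rewrite mulr_sumr [RHS](reindex_inj (mulIg s)); apply: eq_bigr => t _ /=.
by rewrite perm_indexM mulrA -signr_addb odd_permM addbCA addbb addbF.
Qed.

Lemma antisymmetrizationE k (f : tens R n k) :
  alternating_tensor f -> antisymmetrization f = f.
Proof.
move=> fA; apply/ffunP => a; rewrite ffunE.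
under eq_bigr do rewrite fA mulrA -signr_addb addbb mul1r.
rewrite sumr_const card_Sn -[f a *+ _]mulr_natl mulrA mulVf ?mul1r //.
Qed.

Lemma cons_perm_index k c (a : multiindex n k) s :
  cons_index c (perm_index a s) = perm_index (cons_index c a) (lift_perm ord0 ord0 s).
Proof.
apply/ffunP => t; rewrite [RHS]ffunE; case: (unliftP ord0 t) => [u|] ->.
  by rewrite lift_perm_lift !cons_indexS ffunE.
by rewrite lift_perm_id !cons_index0.
Qed.

Lemma alternating_cons k (om : tens R n k.+1) c : alternating_tensor om ->
  alternating_tensor ([ffun a => om (cons_index c a)] : tens R n k).
Proof.
by move=> omA s a; rewrite !ffunE cons_perm_index omA odd_lift_perm.
Qed.

Lemma perm_index_tperm k (a : multiindex n k) (s t : 'I_k) :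
  perm_index a (tperm s t) = set_index (set_index a s (a t)) t (a s).
Proof.
apply/ffunP => u; rewrite !ffunE.
have [->|ut] := eqVneq u t; first by rewrite tpermR.
have [->|us] := eqVneq u s; first by rewrite tpermL.
by rewrite tpermD // eq_sym.
Qed.

Lemma cons_set_index k c (a : multiindex n k) s d :
  cons_index c (set_index a s d) = set_index (cons_index c a) (lift ord0 s) d.
Proof.
apply/ffunP => t; rewrite [RHS]ffunE; case: (unliftP ord0 t) => [u|] ->.
  by rewrite !cons_indexS ffunE (inj_eq lift_inj).
by rewrite !cons_index0.
Qed.

Lemma cons_set_index0 k c d (a : multiindex n k) :
  set_index (cons_index c a) ord0 d = cons_index d a.
Proof.
apply/ffunP => t; rewrite [LHS]ffunE; case: (unliftP ord0 t) => [u|] ->.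
  by rewrite eq_sym (negbTE (neq_lift _ _)) !cons_indexS.
by rewrite eqxx cons_index0.
Qed.

Lemma perm_set_index k (a : multiindex n k) (s : 'S_k) t d :
  perm_index (set_index a t d) s = set_index (perm_index a s) (s^-1 t)%g d.
Proof.
by apply/ffunP => u; rewrite !ffunE (can2_eq (permK s) (permKV s)).
Qed.

(** Skewing the pure trace part over the last k slots removes the terms in which
    g has both indices among them, since g is symmetric.  What is left has one index
    of g in the differentiation slot. *)
Lemma hook_decomposition k g (f : tens R n k.+1) : g^T = g ->
  (forall c, alternating_tensor ([ffun a => f (cons_index c a)] : tens R n k)) ->
  is_tf_hook_part g f 0 ->
  exists (om : tens R n k.+1) (w : 'I_k -> tens R n k),
    [/\ alternating_tensor om,
        forall s a d, w s (set_index a s d) = w s a &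
        forall c a, f (cons_index c a)
          = om (cons_index c a) + \sum_s g c (a s) * w s a].
Proof.
move=> gS fA [_ [_ [u [uI uE]]]].
pose om := antisymmetrization f; have omA : alternating_tensor om.
  exact: antisymmetrization_alternating.
pose G p q (a : multiindex n k.+1) := g (a p) (a q) * u p q a.
have fE a : f a = om a + \sum_(p < k.+1) \sum_(q < k.+1 | (p < q)%N) G p q a.
  by rewrite /G -uE -/om !ffunE; ring.
pose w t : tens R n k := [ffun a : multiindex n k => k`!%:R^-1 * \sum_(s : 'S_k)
  (-1) ^+ s * u ord0 (lift ord0 (s^-1 t)%g) (cons_index (a t) (perm_index a s))].
(* The index in the first slot is irrelevant to u ord0, so a t stands in for it. *)
have u0 q c c' b d : u ord0 (lift ord0 q) (cons_index c (set_index b q d))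
    = u ord0 (lift ord0 q) (cons_index c' b).
  rewrite cons_set_index -(cons_set_index0 c' c b).
  have [_ ->] := uI ord0 (lift ord0 q) (set_index (cons_index c' b) ord0 c) d.
  by have [-> _] := uI ord0 (lift ord0 q) (cons_index c' b) c.
exists om, w; split => //.
  move=> t a d; rewrite !ffunE; congr (_ * _); apply: eq_bigr => s _; congr (_ * _).
  by rewrite perm_set_index; exact: u0.
move=> c a.
have alt_at (h : tens R n k.+1) :
    alternating_tensor ([ffun a => h (cons_index c a)] : tens R n k) ->
    h (cons_index c a)
    = k`!%:R^-1 * \sum_(s : 'S_k) (-1) ^+ s * h (cons_index c (perm_index a s)).
  move=> /antisymmetrizationE/ffunP/(_ a); rewrite !ffunE => <-; congr (_ * _).
  by apply: eq_bigr => s _; rewrite ffunE.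
rewrite (alt_at f (fA c)) (alt_at om (alternating_cons c omA)).
under eq_bigr do rewrite fE mulrDr; rewrite big_split mulrDr; congr (_ + _).
under eq_bigr => s _ do rewrite big_ord_recl mulrDr.
rewrite big_split /= [X in _ * (_ + X)](_ : _ = 0); last first.
  under eq_bigr do rewrite mulr_sumr; rewrite exchange_big big1 // => p _ /=.
  under eq_bigr => s _ do rewrite big_mkcond big_ord_recl /= add0r mulr_sumr.
  rewrite exchange_big big1 // => q _ /=.
  (* The transposition of p and q pairs off the permutations with opposite signs. *)
  case pq : (bump 0 p < bump 0 q)%N; last by rewrite big1 // => s _; rewrite mulr0.
  have pq' : p != q by apply: contraTneq pq => ->; rewrite ltnn.
  apply: (@eq_opp0 R R^o).
  rewrite {1}(reindex_inj (mulgI (tperm p q))) /= -sumrN; apply: eq_bigr => s _.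
  rewrite odd_permM odd_tperm pq' signr_addb expr1 mulN1r mulNr; congr (- (_ * _)).
  rewrite /G !cons_indexS -perm_indexM perm_index_tperm.
  rewrite -!perm_index_tperm !ffunE tpermL tpermR (sym_mxE _ _ gS); congr (_ * _).
  rewrite perm_index_tperm !cons_set_index.
  have [_ ->] := uI (lift ord0 p) (lift ord0 q)
     (set_index (cons_index c (perm_index a s)) (lift ord0 p) (perm_index a s q))
     (perm_index a s p).
  by have [-> _] := uI (lift ord0 p) (lift ord0 q)
     (cons_index c (perm_index a s)) (perm_index a s q).
rewrite addr0; under [RHS]eq_bigr do rewrite ffunE mulrCA.
rewrite -mulr_sumr; congr (_ * _).
under [RHS]eq_bigr do rewrite mulr_sumr.
rewrite [RHS]exchange_big; apply: eq_bigr => s _ /=.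
rewrite [RHS](reindex_inj (@perm_inj _ s)) big_mkcond big_ord_recl /= add0r mulr_sumr.
apply: eq_bigr => t _; rewrite permK /G cons_index0 cons_indexS ffunE mulrCA.
congr (_ * (_ * _)); rewrite -(cons_set_index0 (a (s t)) c).
by have [-> _] := uI ord0 (lift ord0 t) (cons_index (a (s t)) (perm_index a s)) c.
Qed.
End Hook.

Section Divisibility.
Context {R : realType} {n : nat}.
Variables (m : nat) (r : 'I_m -> nat).
Local Notation slot := (@slot m r).
Variables (free : forall l, 'I_(r l)) (pair : slot -> slot).
Hypothesis pairP : complete_pairing free pair.
Local Notation var c := (mpolyX R (mnm1 c) : mpoly n R).

Lemma quadric_dvd_sum (g : 'M[R]_n) (I : Type) (s : seq I) (P : pred I)
    (F : I -> mpoly n R) :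
  (forall j, P j -> exists q, F j = quadric g * q) ->
  exists q, \sum_(j <- s | P j) F j = quadric g * q.
Proof.
move=> Fq; elim/big_rec: _ => [|j p Pj [q ->]]; first by exists 0; rewrite mulr0.
by have [q' ->] := Fq j Pj; exists (q' + q); rewrite mulrDr.
Qed.

(** The three kinds of terms of [hook_decomposition] are treated by [skew_term0],
    [free_term_div] and [suppressed_term0], replacing the form l by w s. *)
Lemma contract_hook_div (g : 'M[R]_n) (S : forall l, tens R n (r l))
    (F : forall l, tens R n (r l).+1) : (0 < n)%N -> g^T = g -> g \in unitmx ->
  (forall y, suppressed free y -> tag (pair y) != tag y) ->
  (forall l, alternating_tensor (S l)) ->
  (forall l c, alternating_tensor ([ffun a => F l (cons_index c a)] : tens R n (r l))) ->
  (forall l, is_tf_hook_part g (F l) 0) ->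
  exists q, \sum_l \sum_(A : {ffun slot -> 'I_n}) \sum_c
      (F l (cons_index c (slice A l)) * \prod_(k | k != l) S k (slice A k))
        *: (var c * weight free pair (invmx g) A) = quadric g * q.
Proof.
move=> n0 gS gU ext SA FA Ftf; apply: quadric_dvd_sum => l _.
have [om [w [omA wI FE]]] := hook_decomposition gS (FA l) (Ftf l).
pose S' s := @eqtype.dfwith _ (fun k => tens R n (r k)) S l (w s).
have S'E s (A : {ffun slot -> 'I_n}) : \prod_k S' s k (slice A k)
    = w s (slice A l) * \prod_(k | k != l) S k (slice A k).
  rewrite (bigD1 l) //= /S' dfwith_in; congr (_ * _).
  by apply: eq_bigr => k kl; rewrite dfwith_out // eq_sym.
rewrite (_ : \sum_(A : {ffun slot -> 'I_n}) _ =
  \sum_(A : {ffun slot -> 'I_n}) \sum_c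
     (om (cons_index c (slice A l)) * \prod_(k | k != l) S k (slice A k))
       *: (var c * weight free pair (invmx g) A)
  + \sum_s \sum_(A : {ffun slot -> 'I_n}) \sum_c
     (g c (A (mkslot s)) * \prod_k S' s k (slice A k))
       *: (var c * weight free pair (invmx g) A)); last first.
  rewrite [X in _ + X]exchange_big -big_split; apply: eq_bigr => A _ /=.
  rewrite [X in _ + X]exchange_big -big_split; apply: eq_bigr => c _ /=.
  rewrite -scaler_suml -scalerDl FE mulrDl mulr_suml; congr ((_ + _) *: _).
  by apply: eq_bigr => s _; rewrite S'E ffunE mulrA.
rewrite (skew_term0 pairP) // add0r; apply: quadric_dvd_sum => s _.
have S'I a d : S' s l (upd a s d) = S' s l a by rewrite /S' dfwith_in; exact: wI.
have [sf|sf] := eqVneq s (free l).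
  by move: S'I; rewrite {}sf; exact: free_term_div.
have ys : suppressed free (mkslot s) by rewrite suppressedE.
exists 0; rewrite mulr0; apply: (suppressed_term0 pairP) => //.
  exact: ext ys.
by move=> k kl; rewrite /S' dfwith_out // eq_sym.
Qed.
End Divisibility.

(** * Contractions of conformal Killing forms *)

Section FormFields.
Local Open Scope classical_set_scope.
Local Open Scope ring_scope.
Context {R : realType} {n : nat} {M : smooth_manifold R n}.

Lemma nabla_cons (g : metric M) i x k (T : wfield M k) c a :
  nabla g T i x (cons_index c a) = partial c (fun y => T g i y a) x
    - \sum_(s < k) \sum_(d < n)
        christoffel g i x d c (a s) * T g i x (set_index a s d).
Proof.
rewrite ffunE tail_cons cons_index0; congr (_ - _).
by apply: eq_bigr => s _; apply: eq_bigr => d _; rewrite cons_indexS.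
Qed.

(** Covariant differentiation commutes with permutations of the slots. *)
Lemma nabla_alternating (g : metric M) i x k (T : wfield M k) : chart_image i x ->
  (forall y, chart_image i y -> alternating_tensor (T g i y)) ->
  (forall a, smooth_on (chart_image i) (fun y => T g i y a)) ->
  forall c, alternating_tensor
    ([ffun a => nabla g T i x (cons_index c a)] : tens R n k).
Proof.
move=> Ux TA TS c s a; rewrite [LHS]ffunE [X in _ * X]ffunE !nabla_cons mulrBr; congr (_ - _).
  have := smooth_on_is_derive c Ux (TS a).
  move=> /(is_derive_mul (is_derive_cst ((-1) ^+ s : R) x (delta_mx 0 c))).
  rewrite mul0r add0r /cst => d.
  have {}d := near_eq_is_derive (near_eq_on (@chart_image_open _ _ _ i) Ux
    (fun y Uy => esym (TA y Uy s a))) d.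
  by have [_ <-] := d.
rewrite mulr_sumr [RHS](reindex_inj (@perm_inj _ s)); apply: eq_bigr => t _ /=.
rewrite mulr_sumr; apply: eq_bigr => d _; rewrite ffunE mulrCA.
congr (_ * _); rewrite -TA //; congr (T _ _ _ _).
by rewrite perm_set_index permK.
Qed.

Lemma contractionE m (r : 'I_m -> nat) (free : forall l, 'I_(r l)) pair
    (sigma : forall l, wfield M (r l)) (h : metric M) i x :
  contraction free sigma pair h i x
  = contract free pair (fun l => sigma l h i x) (invmx (gmx h i x)).
Proof. by []. Qed.

Lemma overlap_chart_image i j (x : 'rV[R]_n) :
  overlap i j x -> chart_image (M := M) j (transition i j x).
Proof. by move=> [_ dj]; exists (param i x). Qed.

(** Taken from the transformation law of a nondegenerate metric. *)
Lemma jacobian_unit (g : metric M) (i j : chart M) x : overlap i j x ->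
  transition_jacobian i j x \in unitmx.
Proof.
move=> ov; have := metric_nondegenerate g ov.1.
by rewrite (metric_transform g ov) !unitmx_mul => /andP[_].
Qed.
End FormFields.

(** A form of rank k has weight k + 1 and an inverse metric has weight - 2.  One
    unit per slot is absorbed by the contracted pairs, and one per form plus one
    per free slot remain. *)
Lemma conformal_weight (R : realType) m (r : 'I_m -> nat) (free : forall l, 'I_(r l))
    pair (u : R) : complete_pairing free pair ->
  (\prod_l expR ((r l).+1%:R * u)) * \prod_(y | leading free pair y) (expR (2 * u))^-1
  = expR ((2 * m)%:R * u).
Proof.
move=> pairP.
have -> : \prod_l expR ((r l).+1%:R * u) = expR u ^+ m * \prod_(y : @slot m r) expR u.
  rewrite big_slot_tag -[X in _ ^+ X]card_ord -prodr_const -big_split /=.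
  apply: eq_bigr => l _; by rewrite prodr_const card_ord expRM_natl exprS.
rewrite (big_slot pairP) /= prodr_const card_ord -!mulrA -big_split /=.
rewrite [X in _ * (_ * X)]big1 => [|y _]; last first.
  by rewrite -expRD -mulr2n -[u *+ 2]mulr_natl mulfV // gt_eqF // expR_gt0.
by rewrite mulr1 -exprD -expRM_natl addnn -mul2n.
Qed.

Theorem theorem5p6 (R : realType) (n : nat) (hn : (3 <= n)%N)
  (M : smooth_manifold R n) (C : conformal_structure M)
  (g : metric M) (hg : metrics_of C g)
  (m : nat) (r : 'I_m -> nat) (sigma : forall i : 'I_m, wfield M (r i))
  (hsigma : forall i : 'I_m, conformal_killing_form C g (sigma i))
  (heven : ~~ odd ((\sum_(i < m) r i) - m)%N)
  (free : forall i : 'I_m, 'I_(r i))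
  (pair : slot -> slot) (hpair : complete_pairing free pair) :
  conformal_killing_tensor C g (tf_sym_field (contraction free sigma pair)).
Proof.
have n0 : (0 < n)%N by exact: leq_trans hn.
have sS h l i a : metrics_of C h ->
    smooth_on (chart_image i) (fun x => sigma l h i x a).
  by move=> hC; have [_ [sS _ _] _ _] := hsigma l; exact: sS.
have sA h l i x : metrics_of C h -> chart_image i x ->
    alternating_tensor (sigma l h i x).
  by move=> hC; have [_ _ sA _] := hsigma l; exact: sA.
have U_open i := @chart_image_open R n M i.
have cS h i b : metrics_of C h ->
    smooth_on (chart_image i) (fun x => contraction free sigma pair h i x b).
  move=> hC; have hS := metric_smooth h i; have hU := metric_nondegenerate h (i := i).
  apply: (@smooth_on_eq _ _ _ (U_open i) (fun x => \sum_(A : {ffun @slot m r -> 'I_n} |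
      [forall l, A (mkslot (free l)) == b l]) (\prod_l sigma l h i x (slice A l))
      * \prod_(y | leading free pair y) invmx (gmx h i x) (A y) (A (pair y)))).
    by move=> x _; rewrite contractionE ffunE.
  apply: (smooth_on_sum (U_open i)) => A _; apply: (smooth_onM (U_open i)).
    by apply: (smooth_on_prod (U_open i)) => l _; exact: sS.
  by apply: (smooth_on_prod (U_open i)) => y _; exact: (smooth_on_invmx (U_open i)).
set T := tf_sym_field _.
have TE h i x : chart_image i x ->
    T h i x = tf_sym_formula (gmx h i x) (contraction free sigma pair h i x).
  by move=> Ux; apply: tf_sym_partE => //; [exact: metric_sym|exact: metric_nondegenerate].
have TS h i a : metrics_of C h -> smooth_on (chart_image i) (fun x => T h i x a).
  move=> hC; apply: (@smooth_on_eq _ _ _ (U_open i) (fun x =>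
    tf_sym_formula (gmx h i x) (contraction free sigma pair h i x) a)).
    by move=> x Ux; rewrite TE.
  apply: (smooth_on_tf_sym_formula (U_open i)) => [x||b].
  - exact: metric_nondegenerate.
  - exact: metric_smooth.
  - exact: cS.
split.
- split=> [h hC i a|h hC i j x ov a|g1 g2 Ups g1C g2C cr i x Ux a].
  + exact: TS.
  + have Uj := overlap_chart_image ov; have JU := jacobian_unit h ov.
    rewrite /T /tf_sym_field.
    rewrite (_ : contraction free sigma pair h i x = pullback (transition_jacobian i j x)
       (contraction free sigma pair h j (transition i j x))).
      rewrite (metric_transform h ov) tf_sym_part_pullback //.
      * by rewrite ffunE.
      * exact: metric_sym.
      * exact: metric_nondegenerate.
    rewrite !contractionE.
    rewrite -(contract_pullback hpair (Ordinal n0) (J := transition_jacobian i j x)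
      (H := invmx (gmx h i x))); last first.
      rewrite (metric_transform h ov); apply: pullback_invmx => //.
      exact: metric_nondegenerate.
    congr (contract _ _ _ _); apply: functional_extensionality_dep => l.
    apply/ffunP => b; rewrite ffunE.
    by have [_ [_ st _] _ _] := hsigma l; exact: st.
  + pose e := expR (2 * Ups (param i x)).
    have e0 : e != 0 by rewrite gt_eqF // expR_gt0.
    have g1U := metric_nondegenerate g1 Ux; have g1S := metric_sym g1 Ux.
    rewrite /T /tf_sym_field contractionE (cr.2 i x Ux) -/e.
    rewrite invmxZ; last by rewrite unitmxZ ?unitfE.
    rewrite (_ : (fun l => sigma l g2 i x) = fun l =>
       scale_tens (expR ((r l).+1%:R * Ups (param i x))) (sigma l g1 i x)); last first.
      apply: functional_extensionality_dep => l; apply/ffunP => b; rewrite scale_tensE.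
      have [_ [_ _ sw] _ _] := hsigma l; exact: (sw g1 g2).
    rewrite contract_scale tf_sym_partZ // scale_tensE; congr (_ * _).
    exact: conformal_weight.
- move=> h hC i x Ux; have hU := metric_nondegenerate h Ux; have hS := metric_sym h Ux.
  have := is_tf_sym_part_formula (contraction free sigma pair h i x) n0 hS hU.
  by rewrite -TE // => -[? []].
move=> i x Ux; have gU := metric_nondegenerate g Ux; have gS := metric_sym g Ux.
split; first by move=> s a; rewrite !ffunE.
split.
  move=> p q _ a; rewrite big1 // => c _; rewrite big1 // => d _.
  by rewrite ffunE mulr0.
rewrite subr0 -symmetrization_poly.
pose c y := contraction free sigma pair g i y.
have [K KE] : exists K, geodesic_derive (christoffel g i x)
    (fun y => tensor_poly (c y)) x (quadric (gmx g i x) * K).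
  (* Either all pairs of slots join two different forms, or the contraction is zero. *)
  have [ext|] := pselect (forall y, suppressed free y -> tag (pair y) != tag y).
    have [K KE] := contract_hook_div hpair n0 gS gU ext
      (fun l => sA g l i x hg Ux)
      (fun l => nabla_alternating Ux (fun y Uy => sA g l i y hg Uy) (fun a => sS g l i a hg))
      (fun l => let: And4 _ _ _ hk := hsigma l in hk i x Ux).
    exists K; rewrite -KE.
    exact: (geodesic_derive_contract Ux hpair (fun l a => sS g l i a hg)).
  move=> /existsNP[y /not_implyP[ys /negP]]; rewrite negbK => /eqP ty.
  exists 0; rewrite mulr0.
  apply: (@geodesic_derive_eq _ _ _ (U_open i) _ (fun=> 0) _ _ _ Ux).
    move=> z Uz; rewrite /c contractionE (contract_internal hpair _ ys ty) //.
    - by rewrite /tensor_poly big1 // => a _; rewrite ffunE scale0r.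
    - exact/invmx_sym/metric_sym.
    - by move=> l; exact: sA.
  by apply: geodesic_derive_cst => d; rewrite mderiv0.
have cF : smooth_family (chart_image i) (fun y => tensor_poly (c y)).
  by apply: (smooth_family_tensor_poly (U_open i)) => b; exact: cS.
have qF := smooth_family_harmonic_quotient (U_open i)
  (fun y Uy => metric_nondegenerate g Uy) (metric_smooth g i) m cF.
have [Q' dq] := geodesic_derive_exists (U_open i) (christoffel g i x) Ux qF.
(* The polynomials of T and of the contraction differ by a multiple of the quadric,
   which is killed by D. *)
have dT : geodesic_derive (christoffel g i x) (fun y => tensor_poly (T g i y)) x
    (quadric (gmx g i x) * (K - Q')).
  have dm1 : geodesic_derive (christoffel g i x) (fun=> -1 : mpoly n R) x 0.
    by apply: geodesic_derive_cst => d; rewrite mderivN -mpolyC1 mderivC oppr0.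
  have d := geodesic_deriveD KE
    (geodesic_deriveM dm1 (geodesic_deriveM (geodesic_derive_quadric g Ux) dq)).
  rewrite (_ : quadric _ * _ = quadric (gmx g i x) * K
     + (0 * (quadric (gmx g i x) * harmonic_quotient (gmx g i x) m (tensor_poly (c x)))
     + -1 * (0 * harmonic_quotient (gmx g i x) m (tensor_poly (c x))
             + quadric (gmx g i x) * Q'))); last by ring.
  apply: (geodesic_derive_eq (U_open i) Ux _ d) => y Uy.
  rewrite mulN1r -harmonic_partE // TE // poly_tensorK //.
  exact/euler_degree_harmonic_part/euler_degree_tensor_poly.
rewrite (geodesic_derive_unique (geodesic_derive_tensor_poly Ux (fun a => TS g i a hg)) dT).
exact: poly_tensor_pure_trace.
Qed.
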